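(* Let $(\Omega,\mathbb{P},\mathcal{F})$ be a probability space, and let $\{\mathcal{F}^{-}_t\}_{t\ge 0}$ and $\{\mathcal{F}^{+}_t\}_{t\geq 0}$ (indexed by real $t\ge 0$) be two families of $\sigma$-algebras on $\Omega$ such that for all $t\ge s\ge 0$, $$\mathcal{F}^{-}_s\subseteq\mathcal{F}^{-}_{t}\subseteq \mathcal{F} \qquad\text{and}\qquad \mathcal{F}\supseteq \mathcal{F}^{+}_{s}\supseteq\mathcal{F}^{+}_{t}.$$ For any real $t\ge 0$ and integers $n>m\geq 0$, let $X_{m,n}^t:\Omega\to [0,\infty)$ be a random variable. Let there be $C\ge 0$ such that the following statements hold for all such $t,m,n$. (1) $X_{m,n}^t \leq X_{m,k}^t+X_{k,n}^{t+X_{m,k}^t}$ for all $k\in\{m+1,\dots,n-1\}$; (2* ) $X_{0,1}^0\le C$; (3) the joint distribution of $\{X_{m,m+1}^t, X_{m,m+2}^t, \dots \}$ is independent of $(t,m)$; (4) $X_{m,n}^t$ is $\mathcal{F}^+_t$-measurable, and $\{\omega\in\Omega\,|\, X_{m,n}^t(\omega)\le s\}\in \mathcal{F}^{-}_{t+s}$ for any $s\ge 0$; (5* ) $\lim_{s\to\infty}\phi(s)=0$, where $$\phi(s):=\sup\left\{\left| \mathbb{P}[F|E] -\mathbb{P}[F]\right| \,\big|\, t\ge 0,\ (E,F)\in \mathcal{F}_t^- \times \mathcal{F}_{t+s}^+,\ \mathbb{P}[E]>0 \right\};$$ (6) $X_{m,n}^t \leq X_{m,n}^{t+s}+s$ for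 all $s\in [C,C+c]$, with some $c>0$ (independent of $t,m,n$). Then $\lim_{n\to\infty}\frac{\mathbb{E}[X_{0,n}^0]}{n}$ exists and $$\lim_{n\to\infty}\frac{X_{0,n}^0}{n} =\lim_{n\to \infty}\frac{\mathbb{E}[X_{0,n}^{0}]}{n}\qquad\text{in probability}.$$ If, in addition, there is $\alpha>0$ such that $\lim_{s\to\infty} s^\alpha \phi(s)=0$, then also $$\lim_{n\to \infty}\frac{X_{0,n}^0 }{n}= \lim_{n\to \infty}\frac{\mathbb{E}[X_{0,n}^0]}{n}\qquad\text{almost surely.}$$ Moreover, if $C\in\mathbb{N}$ and all the $X_{m,n}^t$ are integer-valued, then the same conclusions hold when (6) is only assumed with $c=0$ (that is, only for $s=C$).
   Context: $\mathbb{N}=\{1,2,\dots\}$. The notation $X_{k,n}^{t+X_{m,k}^t}$ denotes the function $\omega\mapsto X_{k,n}^{t+X_{m,k}^t(\omega)}(\omega)$. *)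

(* Defs.v *)
From HB Require Import structures.
From mathcomp Require Export all_boot all_order all_algebra.
From mathcomp Require Export all_classical all_reals all_analysis.
Export Order.TTheory GRing.Theory Num.Theory.
Export numFieldNormedType.Exports.

Set Implicit Arguments.
Unset Strict Implicit.
Unset Printing Implicit Defensive.

Local Open Scope classical_set_scope.
Local Open Scope ring_scope.

(* Junk value 0 when [P E = 0], since [0^-1 = 0]. *)
Definition cond_prob d (T : measurableType d) (R : realType)
    (P : probability T R) (F E : set T) : R :=
  fine (P (F `&` E)) / fine (P E).

(* The set below consists of numbers in [0, 1] and contains 0 as soon as the
   [Fm t] and [Fp t] are sub-sigma-algebras, so [sup] is the true supremum. *)
Definition mixing_coef d (T : measurableType d) (R : realType)
    (P : probability T R) (Fm Fp : R -> set (set T)) (s : R) : R :=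
  sup [set x | exists t E F,
    [/\ 0 <= t, Fm t E, Fp (t + s) F, (0 < P E)%E
      & x = `|cond_prob P F E - fine (P F)|] ].

Definition seq_measurable (R : realType) : set (set (nat -> R)) :=
  <<s \bigcup_i preimage_set_system setT (fun x : nat -> R => x i)
                  (@measurable _ R) >>.

Definition same_joint_law d (T : measurableType d) (R : realType)
    (P : probability T R) (Y Z : nat -> T -> R) : Prop :=
  forall B : set (nat -> R), seq_measurable B ->
    P ((fun w => Y ^~ w) @^-1` B) = P ((fun w => Z ^~ w) @^-1` B).

Definition cvg_in_probability d (T : measurableType d) (R : realType)
    (P : probability T R) (Y : nat -> T -> R) (Z : T -> R) : Prop :=
  forall e : R, 0 < e ->
    P [set w | e < `|Y n w - Z w|] @[n --> \oo] --> 0%E.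

(* The index [n = 0] of the sequences is irrelevant to the limits.  The
   expectation is taken in [\bar R], where convergence to the real number [l]
   forces it to be finite for all large [n]. *)
Definition time_constant_limits d (T : measurableType d) (R : realType)
    (P : probability T R) (Y : nat -> T -> R) (phi : R -> R) : Prop :=
  exists l : R,
    [/\ ('E_P[Y n] * (n%:R^-1)%:E)%E @[n --> \oo] --> l%:E,
        cvg_in_probability P (fun n w => Y n w / n%:R) (cst l)
      & (exists2 a : R, 0 < a & (s `^ a * phi s) @[s --> +oo] --> 0) ->
        {ae P, forall w, Y n w / n%:R @[n --> \oo] --> l}].

Definition time_shift_bound (T : Type) (R : realType)
    (X : R -> nat -> nat -> T -> R) (C c : R) : Prop :=
  forall (t s : R) (m n : nat) (w : T), 0 <= t -> (m < n)%N ->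
    C <= s <= C + c -> X t m n w <= X (t + s) m n w + s.

(* Main.v *)
Require Import Defs.
From mathcomp Require Import ring lra zify measurable_realfun.

Set Implicit Arguments.
Unset Strict Implicit.
Unset Printing Implicit Defensive.

Local Open Scope classical_set_scope.
Local Open Scope ring_scope.

(** Write [X_n] for [X 0 0 n].  The proof shows that [X_n / n] converges almost
    surely to a constant [l], with [X_n <= unit_cost * n] almost surely;
    dominated convergence then gives the limit of the expectations and the
    convergence in probability ([ae_cvg_mean_probability]).

    Two devices make subadditivity usable at random times.  Passage times are
    rounded up to a multiple of a mesh [delta], so that only countably many
    starting times occur and the event that the rounded time is [i] belongs to
    [Fm (t + delta * i)].  By the time shift bound one may moreover wait a
    multiple of [C] before starting the next passage, at the price of the wait
    only ([concat_after_wait]).  After a wait [g], what follows is independent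
    of the past up to an error [phi g], where [phi] is the mixing coefficient,
    that is relative to the probability of the past event ([profile_mixing]).

    Upper bound ([upper_as]).  Let [l] be the lower limit of the normalized
    mean rounded passage times.  Choose a block length [m] almost achieving
    [l] and concatenate [q] blocks with waits in between.  Given the past, each
    block has conditional mean at most the unconditional one plus a multiple of
    [phi g]; since this holds conditionally on every past event, the exponential
    moments multiply and the Chernoff bound [chernoff_adapted_sum] gives a
    probability of excess that is geometric in [q], for one fixed small value
    of [phi g].  Borel-Cantelli concludes.

    Lower bound ([lower_null]).  For [th < l], consider the event [V] that
    [X_n - th * n] is unbounded below.  Delaying the start by a multiple of [C]
    gives an event with the same probability contained in [V], hence almost
    equal to it, and lying in the far future; so mixing makes [V] independent of
    events of bounded past.  If [V] had positive probability, then with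
    probability close to 1 the sequence would dip below the line of slope [th]
    within a bounded number [B] of sites ([dips_likely]).  Now look along the
    deterministic index [u] at the sequence [X_u]: the passage from [u] after
    time [X_u] and a wait has nearly the law of the passage from the origin, so
    for each [u] the probability that no [n <= B] satisfies
    [X_(u+n) <= X_u + th * n] is small.  Covering the sites
    greedily by such stretches ([greedy_covering]) and taking expectations makes
    the mean of [X_N / N] eventually smaller than [l], a contradiction.  Indexing
    by the deterministic [u], and not by the sites that the greedy covering
    visits, is what avoids conditioning on earlier failures, whose detection
    looks far into the future. *)

(** * Bounded random variables over a probability space *)

Section bounded_variables.
Context (R : realType) d (T : measurableType d) (P : probability T R).
Implicit Types (A B : set T) (f g : T -> R).

Definition pr A : R := fine (P A).
Definition mean f : R := \int[P]_w f w.

Definition bounded_rv f : Prop :=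
  measurable_fun setT f /\ exists M, forall w, `|f w| <= M.

Lemma prT : pr setT = 1. Proof. by rewrite /pr probability_setT. Qed.

(** Every expectation below is that of a bounded variable, mostly a finite
    combination of indicators, so the side conditions of integration reduce to
    [bounded_rv]. *)
Lemma bounded_rv_integrable f :
  bounded_rv f -> P.-integrable setT (EFin \o f).
Proof.
move=> [mf [M fM]]; apply: measurable_bounded_integrable => //.
  by rewrite ltey_eq fin_num_measure.
by exists M; split; [exact: num_real|move=> x Mx w _ /=; apply: le_trans (ltW Mx)].
Qed.

Lemma bounded_rv_cst (c : R) : bounded_rv (fun=> c).
Proof. by split; [exact: measurable_cst|exists `|c|]. Qed.

Lemma bounded_rvD f g :
  bounded_rv f -> bounded_rv g -> bounded_rv (fun w => f w + g w).
Proof.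
move=> [mf [M fM]] [mg [N gN]]; split; first exact: measurable_funD.
by exists (M + N) => w; apply: le_trans (ler_normD _ _) _; apply: lerD.
Qed.

Lemma bounded_rvM f g :
  bounded_rv f -> bounded_rv g -> bounded_rv (fun w => f w * g w).
Proof.
move=> [mf [M fM]] [mg [N gN]]; split; first exact: measurable_funM.
by exists (M * N) => w; rewrite normrM ler_pM.
Qed.

Lemma bounded_rvZ (c : R) f : bounded_rv f -> bounded_rv (fun w => c * f w).
Proof. exact/bounded_rvM/bounded_rv_cst. Qed.

Lemma bounded_rv_sum (I : Type) (r : seq I) (f : I -> T -> R) :
  (forall i, bounded_rv (f i)) -> bounded_rv (fun w => \sum_(i <- r) f i w).
Proof.
move=> bf; elim: r => [|i r IHr].
  by under eq_fun do rewrite big_nil; exact: bounded_rv_cst.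
by under eq_fun do rewrite big_cons/=; exact: bounded_rvD.
Qed.

Lemma bounded_rv_indic A : measurable A -> bounded_rv (\1_A : T -> R).
Proof.
move=> mA; split; first exact: measurable_indic.
by exists 1 => w; rewrite indicE; case: (_ \in _); rewrite ?normr1 ?normr0.
Qed.

Lemma mean_cst (c : R) : mean (fun=> c) = c.
Proof. by rewrite /mean Rintegral_cst// -[fine _]/(pr setT) prT mulr1. Qed.

Lemma meanD f g : bounded_rv f -> bounded_rv g ->
  mean (fun w => f w + g w) = mean f + mean g.
Proof. by move=> bf bg; apply: RintegralD => //; exact: bounded_rv_integrable. Qed.

Lemma meanZ (c : R) f : bounded_rv f -> mean (fun w => c * f w) = c * mean f.
Proof. by move=> bf; apply: RintegralZl => //; exact: bounded_rv_integrable. Qed.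

Lemma mean_sum (I : Type) (r : seq I) (f : I -> T -> R) :
  (forall i, bounded_rv (f i)) ->
  mean (fun w => \sum_(i <- r) f i w) = \sum_(i <- r) mean (f i).
Proof.
move=> bf; elim: r => [|i r IHr].
  by rewrite big_nil; under eq_fun do rewrite big_nil; exact: mean_cst.
rewrite big_cons/= -IHr -meanD//; last exact: bounded_rv_sum.
by congr mean; apply/funext => w; rewrite big_cons.
Qed.

Lemma mean_indic A : measurable A -> mean \1_A = pr A.
Proof. by move=> mA; rewrite /mean /Rintegral integral_indic// setIT. Qed.

Lemma mean_le f g : bounded_rv f -> bounded_rv g -> (forall w, f w <= g w) ->
  mean f <= mean g.
Proof. by move=> bf bg fg; apply: le_Rintegral => //; exact: bounded_rv_integrable. Qed.

Lemma mean_le_as (Om : set T) f g : measurable Om -> P (~` Om) = 0%E ->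
  bounded_rv f -> bounded_rv g -> (forall w, Om w -> f w <= g w) ->
  mean f <= mean g.
Proof.
move=> mO PO bf bg fg.
have eqm h : bounded_rv h -> mean h = mean (fun w => h w * \1_Om w).
  move=> [mh [M hM]]; rewrite /mean /Rintegral; congr fine.
  apply: ae_eq_integral => //=.
  - exact/measurable_EFinP.
  - by apply/measurable_EFinP/measurable_funM => //; exact: measurable_indic.
  - exists (~` Om); split => //; first exact: measurableC.
    move=> w /=; apply: contra_not => Ow _.
    by rewrite indicE mem_set// mulr1.
rewrite (eqm f)// (eqm g)//.
have bO : bounded_rv (\1_Om : T -> R) by exact: bounded_rv_indic.
apply: mean_le; [exact: bounded_rvM..|].
move=> w; rewrite indicE; case: (boolP (w \in Om)) => [/set_mem Ow|_].
  by rewrite !mulr1 fg.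
by rewrite !mulr0.
Qed.

Lemma measure_prE A : measurable A -> P A = (pr A)%:E.
Proof. by move=> mA; rewrite /pr fineK// fin_num_measure. Qed.

Lemma pr_ge0 A : 0 <= pr A.
Proof. exact/fine_ge0/measure_ge0. Qed.

Lemma pr_le A B : measurable A -> measurable B -> A `<=` B -> pr A <= pr B.
Proof.
by move=> mA mB AB; rewrite -lee_fin -!measure_prE//; apply: le_measure => //; rewrite inE.
Qed.

Lemma pr_le1 A : measurable A -> pr A <= 1.
Proof. by move=> mA; rewrite -prT; apply: pr_le. Qed.

Lemma prC A : measurable A -> pr (~` A) = 1 - pr A.
Proof.
by move=> mA; rewrite /pr probability_setC// fineB// fin_num_measure.
Qed.

Lemma pr_setID A B : measurable A -> measurable B ->
  pr A = pr (A `&` B) + pr (A `&` ~` B).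
Proof.
move=> mA mB.
have mAB : measurable (A `&` B) by exact: measurableI.
have mAC : measurable (A `&` ~` B) by apply: measurableI => //; exact: measurableC.
rewrite -!mean_indic// -meanD; [|exact: bounded_rv_indic..].
congr mean; apply/funext => w; rewrite !indicE !in_setI in_setC.
by case: (w \in A); case: (w \in B); rewrite /= ?addr0 ?add0r.
Qed.

Lemma pr_setDeq0 A B : measurable A -> measurable B -> B `<=` A -> pr A = pr B ->
  pr (A `&` ~` B) = 0.
Proof.
move=> mA mB BA eqAB; have := pr_setID mA mB.
rewrite [A `&` B]setIC (setIidl BA) eqAB -{1}[pr B]addr0.
by move=> /addrI <-.
Qed.

End bounded_variables.

Arguments mean {R d T} P f.
Arguments pr {R d T} P A.

(** * A Chernoff bound for adapted sums *)

(** Reciprocal of the tangent bound for [expR (- y)]. *)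
Lemma expR_le_quadratic (R : realType) (y : R) :
  0 <= y <= 2^-1 -> expR y <= 1 + y + 2 * y ^+ 2.
Proof.
move=> /andP[y0 y1].
have hexp : 1 - y <= (expR y)^-1 by rewrite -expRN; exact: expR_ge1Dx.
have y'0 : 0 < 1 - y by lra.
have {hexp} : expR y * (1 - y) <= 1.
  by rewrite -ler_pdivlMl ?expR_gt0// mulr1.
move=> h; rewrite -(ler_pM2r y'0); apply: (le_trans h).
have : 0 <= y ^+ 2 * (1 - 2 * y) by apply: mulr_ge0; [exact: sqr_ge0|lra].
by move=> ?; nra.
Qed.

Section chernoff.
Context (R : realType) d (T : measurableType d) (P : probability T R).

Lemma nat_sum_ltn (M a : nat) : (a <= M)%N ->
  a%:R = \sum_(u < M) (u < a)%N%:R :> R.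
Proof.
move=> aM; rewrite -natr_sum -(big_mkord xpredT (fun u => nat_of_bool (u < a)%N)).
congr (_%:R); rewrite (big_cat_nat (n := a))//= big_nat.
rewrite [X in (X + _)%N](eq_bigr (fun=> 1%N)); last by move=> i /andP[_ ->].
rewrite -big_nat sum_nat_const_nat subn0 muln1 big_nat big1 ?addn0//.
by move=> i /andP[ai _]; rewrite ltnNge ai.
Qed.

(** [s] is a sum of increments in [0, M], the [k]-th of which depends on the
    current value [i] of [s] through [A k i]; the hypothesis on the sums of
    probabilities says that its conditional mean given [s k = i] is at most
    [M * beta].  Hence each step multiplies the exponential moment of
    parameter [lam / M] by at most [1 + lam * beta + 2 * lam ^+ 2], and
    Markov's inequality concludes. *)
Lemma chernoff_adapted_sum (M : nat) (A : nat -> nat -> T -> nat)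
    (s : nat -> T -> nat) (beta lam x : R) :
  (0 < M)%N ->
  (forall k i w, (A k i w <= M)%N) ->
  (forall k i u, measurable [set w | (u < A k i w)%N]) ->
  (forall k i, measurable [set w | s k w = i]) ->
  (forall w, s 0%N w = 0%N) ->
  (forall k w, s k.+1 w = (s k w + A k (s k w) w)%N) ->
  (forall k i, \sum_(u < M)
      pr P ([set w | s k w = i] `&` [set w | (u < A k i w)%N])
    <= M%:R * beta * pr P [set w | s k w = i]) ->
  0 <= lam <= 2^-1 ->
  forall q, pr P [set w | x * M%:R * q%:R <= (s q w)%:R]
            <= expR (lam * beta + 2 * lam ^+ 2 - lam * x) ^+ q.
Proof.
move=> M0 AM mA ms s0 sS hbeta lam01 q.
have Mp : 0 < M%:R :> R by rewrite ltr0n.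
case/andP: (lam01) => lam0 lam1.
pose e (i : nat) : R := expR (lam / M%:R * i%:R).
have e0 i : 0 <= e i by exact: expR_ge0.
have eD i j : e (i + j)%N = e i * e j by rewrite /e natrD mulrDr expRD.
have sM k w : (s k w <= k * M)%N.
  by elim: k w => [|k IHk] w; rewrite ?s0// sS mulSn addnC leq_add.
pose S k i := [set w | s k w = i].
pose D k i u := S k i `&` [set w | (u < A k i w)%N].
have mS k i : measurable (S k i).
  exact: ms.
have mD k i u : measurable (D k i u) by exact: measurableI.
have bS k i : bounded_rv (fun w => e i * \1_(S k i) w).
  exact/bounded_rvZ/bounded_rv_indic.
have esE k w : e (s k w) = \sum_(i < (k * M).+1) e i * \1_(S k i) w.
  have si : (s k w < (k * M).+1)%N by rewrite ltnS.
  rewrite (bigD1 (Ordinal si))//= big1 ?addr0; last first.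
    move=> i /eqP ni; rewrite indicE memNset ?mulr0// => sw.
    by apply: ni; apply/val_inj.
  by rewrite indicE mem_set ?mulr1.
have bes k : bounded_rv (fun w => e (s k w)).
  by under eq_fun do rewrite esE; exact: bounded_rv_sum.
pose a := 1 + 2 * lam ^+ 2.
have a0 : 0 <= a.
  by rewrite /a; have := sqr_ge0 lam; lra.
pose b := lam / M%:R.
have b0 : 0 <= b by rewrite divr_ge0.
(* Split according to the value of [s k]; on each piece the exponential is
   bounded by a polynomial of degree 1 in indicators. *)
have step k : mean P (fun w => e (s k.+1 w)) <=
    (a + lam * beta) * mean P (fun w => e (s k w)).
  pose g i w := e i * (a * \1_(S k i) w + b * \sum_(u < M) \1_(D k i u) w).
  have bD i : bounded_rv (fun w => \sum_(u < M) \1_(D k i u) w : R).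
    by apply: bounded_rv_sum => u; exact: bounded_rv_indic.
  have bg i : bounded_rv (g i).
    apply: bounded_rvZ; apply: bounded_rvD; apply: bounded_rvZ => //.
    exact: bounded_rv_indic.
  have mg i : mean P (g i) =
      e i * (a * pr P (S k i) + b * \sum_(u < M) pr P (D k i u)).
    rewrite /g meanZ; last first.
      by apply: bounded_rvD; apply: bounded_rvZ => //; exact: bounded_rv_indic.
    rewrite meanD; [|by apply: bounded_rvZ => //; exact: bounded_rv_indic..].
    rewrite meanZ; last exact: bounded_rv_indic.
    rewrite meanZ// mean_indic// mean_sum; last by move=> u; exact: bounded_rv_indic.
    by congr (_ * (_ + _ * _)); apply: eq_bigr => u _; rewrite mean_indic.
  apply: (@le_trans _ _ (mean P (fun w => \sum_(i < (k * M).+1) g i w))).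
    apply: mean_le => //; first exact: bounded_rv_sum.
    move=> w; have si : (s k w < (k * M).+1)%N by rewrite ltnS.
    rewrite (bigD1 (Ordinal si))//=; apply: ler_wpDr.
      apply: sumr_ge0 => i _; apply: mulr_ge0 => //; apply: addr_ge0.
        by rewrite mulr_ge0// indicE.
      by apply: mulr_ge0 => //; apply: sumr_ge0.
    rewrite sS eD /g ler_wpM2l//.
    rewrite indicE mem_set// mulr1.
    set Aw := A k (s k w) w; have AwM : (Aw <= M)%N by exact: AM.
    have -> : \sum_(u < M) \1_(D k (s k w) u) w = Aw%:R :> R.
      rewrite (nat_sum_ltn AwM); apply: eq_bigr => u _; rewrite indicE.
      congr (_%:R); congr nat_of_bool; apply/idP/idP => [/set_mem[]//|h].
      exact/mem_set.
    have h0 : 0 <= b * Aw%:R by rewrite mulr_ge0.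
    have h1 : b * Aw%:R <= lam.
      by rewrite /b mulrAC ler_pdivrMr// ler_wpM2l// ler_nat.
    have h2 : 0 <= b * Aw%:R <= 2^-1 by rewrite h0 (le_trans h1).
    apply: le_trans (expR_le_quadratic h2) _.
    rewrite /a addrAC lerD2r lerD2l ler_pM2l// ler_sqr ?nnegrE//.
  rewrite mean_sum//.
  have -> : mean P (fun w => e (s k w)) = \sum_(i < (k * M).+1) e i * pr P (S k i).
    under eq_fun do rewrite esE.
    rewrite mean_sum//; apply: eq_bigr => i _.
    by rewrite meanZ ?mean_indic//; exact: bounded_rv_indic.
  rewrite mulr_sumr; apply: ler_sum => i _; rewrite mg [leRHS]mulrCA ler_wpM2l//.
  rewrite [leRHS]mulrDl lerD2l.
  apply: le_trans (ler_wpM2l b0 (hbeta k i)) _.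
  by rewrite /b -!mulrA mulKf// gt_eqF.
set c := expR (lam * beta + 2 * lam ^+ 2).
have mexp k : mean P (fun w => e (s k w)) <= c ^+ k.
  elim: k => [|k IHk].
    under eq_fun do rewrite s0 /e mulr0 expR0.
    by rewrite mean_cst.
  apply: le_trans (step k) _; rewrite exprS.
  have m0 : 0 <= mean P (fun w => e (s k w)).
    rewrite -(mean_cst P 0); apply: mean_le => [||w]; [exact: bounded_rv_cst|exact: bes|].
    exact: e0.
  apply: le_trans (ler_wpM2l (expR_ge0 _) IHk); apply: ler_wpM2r => //.
  by apply: le_trans (expR_ge1Dx _); rewrite /a; lra.
pose F := [set w | x * M%:R * q%:R <= (s q w)%:R].
have mF : measurable F.
  have -> : F = \bigcup_(i in [set i | x * M%:R * q%:R <= i%:R]) S q i.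
    apply/seteqP; split=> [w Fw|w [i xi swi]]; first by exists (s q w).
    by rewrite /F /= (swi : s q w = i).
  exact: bigcup_measurable.
have hF : pr P F <= mean P (fun w => expR (- (lam * x * q%:R)) * e (s q w)).
  rewrite -mean_indic//; apply: mean_le; first exact: bounded_rv_indic.
    exact: bounded_rvZ.
  move=> w; rewrite indicE; have [/set_mem Fw|_] := boolP (w \in F); last first.
    by rewrite mulr_ge0// expR_ge0.
  rewrite -expRD -[leLHS]expR0 ler_expR addrC subr_ge0.
  apply: le_trans (ler_wpM2l _ Fw); last by rewrite divr_ge0.
  by rewrite le_eqVlt; apply/orP; left; apply/eqP; field; rewrite gt_eqF.
apply: le_trans hF _; rewrite meanZ// expRD exprMn mulrC ler_pM ?expR_ge0//.
- rewrite -(mean_cst P 0); apply: mean_le => [||w]; [exact: bounded_rv_cst|exact: bes|].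
  exact: e0.
- by rewrite -expRM_natr mulNr.
Qed.

End chernoff.

(** * Covering, Borel-Cantelli and consequences of almost sure convergence *)

(** From a site that is not bad, jump ahead along slope [th]; from a bad site,
    move one site at cost [K].  The last jump may overshoot [N], which costs at
    most [(K - th) * B]. *)
Lemma greedy_covering (R : realType) (x : nat -> R) (bad : pred nat) (th K : R) (B : nat) :
  th <= K ->
  (forall u, (0 < u)%N -> x u.+1 <= x u + K) ->
  (forall u, (0 < u)%N -> ~~ bad u ->
     exists n, (0 < n <= B)%N /\ x (u + n)%N <= x u + th * n%:R) ->
  forall N u, (0 < u <= N)%N ->
  x N <= x u + th * (N - u)%:R + (K - th) * (\sum_(u <= v < N) bad v)%:R
         + (K - th) * B%:R.
Proof.
move=> thK xS good N u; move: {2}(N - u)%N (leqnn (N - u)) => m.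
have K0 : 0 <= K - th by rewrite subr_ge0.
elim: m u => [|m IHm] u uNm /andP[u0 uN].
  have -> : u = N by apply/eqP; rewrite eqn_leq uN -subn_eq0 -leqn0.
  by rewrite subnn big_geq// !mulr0 !addr0 lerDl mulr_ge0.
move: uN; rewrite leq_eqVlt => /predU1P[->|uN].
  by rewrite subnn big_geq// !mulr0 !addr0 lerDl mulr_ge0.
have far v : (v <= N - u)%N -> x (u + v)%N <= x u + K * v%:R.
  elim: v => [|v IHv] vN; first by rewrite addn0 mulr0 addr0.
  rewrite addnS; apply: le_trans (xS _ _) _; first by rewrite addn_gt0 u0.
  by rewrite -addn1 natrD mulrDr mulr1 addrA lerD2r IHv// ltnW.
have [bu|/good[//|n [/andP[n0 nB] xn]]] := boolP (bad u).
  apply: (le_trans (IHm u.+1 _ _)); last 2 first.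
  - by rewrite uN.
  - rewrite [in leRHS]big_ltn// bu natrD subnS.
    have -> : (N - u)%:R = (N - u).-1%:R + 1 :> R.
      by rewrite natr1 prednK// subn_gt0.
    rewrite -[nat_of_bool true]/1%N; have := xS u u0; rewrite !mulrDr; lra.
  - by rewrite subnS; case: (N - u)%N uNm.
have [nN|Nn] := leqP n (N - u).
  have uNn : (u + n <= N)%N by rewrite -leq_subRL// ltnW.
  apply: (le_trans (IHm (u + n)%N _ _)).
  - rewrite subnDA leq_subLR (leq_trans uNm)//.
    by rewrite -add1n leq_add2r.
  - by rewrite addn_gt0 u0.
  rewrite [in leRHS](big_cat_nat (n := (u + n)%N))//= ?leq_addr//.
  have -> : (N - u)%:R = n%:R + (N - (u + n))%:R :> R.
    by rewrite subnDA -natrD subnKC.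
  rewrite natrD !mulrDr.
  have : 0 <= (K - th) * (\sum_(u <= v < u + n) bad v)%:R by rewrite mulr_ge0.
  by lra.
have := far _ (leqnn (N - u)); rewrite subnKC ?(ltnW uN)// => h.
apply: (le_trans h).
have h1 : (K - th) * (N - u)%:R <= (K - th) * B%:R.
  by rewrite ler_wpM2l// ler_nat ltnW// (leq_trans Nn).
have : 0 <= (K - th) * (\sum_(u <= v < N) bad v)%:R by rewrite mulr_ge0.
by lra.
Qed.

Section almost_sure.
Context (R : realType) d (T : measurableType d) (P : probability T R).

Lemma borel_cantelli_geometric (F : nat -> set T) (r : R) :
  0 < r < 1 -> (forall k, measurable (F k)) -> (forall k, pr P (F k) <= r ^+ k) ->
  {ae P, forall w, exists n0, forall k, (n0 <= k)%N -> ~ F k w}.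
Proof.
move=> /andP[r0 r1] mF Fr.
have F0 : P (lim_sup_set F) = 0%E.
  apply: lim_sup_set_cvg0 => //.
  apply: (@le_lt_trans _ _ ((1 - r)^-1)%:E); last by rewrite ltry.
  apply: lime_le; first by apply: is_cvg_nneseries => n _ _; exact: measure_ge0.
  apply: nearW => n.
  have r1' : `|r| < 1 by rewrite gtr0_norm.
  have := geometric_le_lim n ler01 r0 r1'; rewrite mul1r -lee_fin; apply: le_trans.
  rewrite /series/= -sumEFin; apply: lee_sum => k _.
  by rewrite measure_prE// lee_fin mul1r.
exists (lim_sup_set F); split=> //.
  by apply: bigcap_measurable => // k _; exact: bigcup_measurable.
move=> w /= nw n _.
apply: contrapT => nF; apply: nw; exists n => k nk Fk.
by apply: nF; exists k.
Qed.

(** Dominated convergence gives both the convergence of expectations and that of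
    [E |Z n - l|] to 0, hence convergence in probability by Markov. *)
Lemma ae_cvg_mean_probability (Z : nat -> T -> R) (l K : R) :
  (forall n, measurable_fun setT (Z n)) ->
  {ae P, forall w, forall n, `|Z n w| <= K} ->
  {ae P, forall w, Z n w @[n --> \oo] --> l} ->
  ('E_P[Z n] @[n --> \oo] --> l%:E)%E /\ cvg_in_probability P Z (cst l).
Proof.
move=> mZ ZK Zl.
have mEZ n : measurable_fun setT (EFin \o Z n) by exact/measurable_EFinP.
have mEl : measurable_fun setT (fun _ : T => l%:E) by exact: measurable_cst.
have Zl' : {ae P, forall w, setT w -> (EFin \o Z n) w @[n --> \oo] --> l%:E}.
  by apply: filterS Zl => w Zw _; apply: cvg_EFin => //; exact: nearW.
have iK : P.-integrable setT (fun=> K%:E).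
  exact: (bounded_rv_integrable P (bounded_rv_cst T K)).
have ZK' : {ae P, forall w n, setT w -> (`|(EFin \o Z n) w| <= K%:E)%E}.
  by apply: filterS ZK => w Zw n _; rewrite /= lee_fin.
have [_ h1 h2] := dominated_convergence measurableT mEZ mEl Zl' iK ZK'.
split.
  rewrite integral_cst// in h2.
  move: h2; rewrite (_ : (l%:E * _)%E = l%:E); last first.
    by rewrite -[RHS]mule1; congr (_ * _)%E; exact: probability_setT.
  by rewrite unlock.
move=> e e0; apply/(@squeeze_cvge _ _ _ _ (fun=> 0%E) _ (fun n =>
  e^-1%:E * \int[P]_w `|(EFin \o Z n) w - l%:E|)%E); last 2 first.
- exact: cvg_cst.
- by rewrite -[X in _ --> X](mule0 e^-1%:E); apply: cvgeZl.
apply: nearW => n; rewrite measure_ge0/=.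
have mZl : measurable_fun setT (fun w => (EFin \o Z n) w - l%:E)%E.
  exact: emeasurable_funB.
have mF : measurable [set w | (e%:E <= `|(EFin \o Z n) w - l%:E|)%E].
  rewrite -[X in measurable X]setTI.
  apply: emeasurable_fun_c_infty => //; exact: measurableT_comp.
rewrite lee_pdivlMl//.
have := @le_integral_comp_abse _ _ _ P _ measurableT _ e id (@measurable_id _ _ _)
  (fun r r0 => r0) (fun x y _ _ xy => xy) mZl e0.
rewrite setTI; apply: le_trans; rewrite lee_pmul2l//.
apply: le_measure; rewrite ?inE//; last by move=> w /= /ltW.
have mb : measurable_fun setT (fun w => e < `|Z n w - l|).
  apply: measurable_fun_ltr; first exact: measurable_cst.
  by apply: measurableT_comp => //; exact: measurable_funB.
by have := mb measurableT [set true] I; rewrite setTI.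
Qed.

End almost_sure.

(** * Sigma-algebras, mixing and approximation of events *)

Section sigma_algebra_closure.
Context (T : Type) (G : set (set T)) (sG : sigma_algebra setT G).

Lemma sigma_setT : G setT.
Proof. by case: sG => G0 GC _; rewrite -(setD0 setT); exact: GC. Qed.

Lemma sigma_setC A : G A -> G (~` A).
Proof. by case: sG => _ GC _ GA; rewrite -setTD; exact: GC. Qed.

Lemma sigma_bigcup (D : set nat) (A : nat -> set T) :
  (forall i, D i -> G (A i)) -> G (\bigcup_(i in D) A i).
Proof.
case: sG => G0 _ GU GA; rewrite bigcup_mkcond; apply: GU => i.
by case: ifPn => [/set_mem/GA//|_].
Qed.

Lemma sigma_bigcap (D : set nat) (A : nat -> set T) :
  (forall i, D i -> G (A i)) -> G (\bigcap_(i in D) A i).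
Proof.
move=> GA; rewrite -[X in G X]setCK setC_bigcap; apply: sigma_setC.
by apply: sigma_bigcup => i Di; apply/sigma_setC/GA.
Qed.

Lemma sigma_setI A B : G A -> G B -> G (A `&` B).
Proof.
move=> GA GB; rewrite -bigcap2E; apply: sigma_bigcap => -[|[|i]] _ //=.
exact: sigma_setT.
Qed.

End sigma_algebra_closure.

Lemma seq_measurable_coord (R : realType) (n : nat) (B : set R) :
  measurable B -> seq_measurable [set x : nat -> R | B (x n)].
Proof.
move=> mB; apply: sub_sigma_algebra; exists n => //; exists B => //.
by rewrite setTI.
Qed.

Lemma seq_measurable_le (R : realType) (n : nat) (a : R) :
  seq_measurable [set x : nat -> R | x n <= a].
Proof.
have := @seq_measurable_coord R n `]-oo, a] (measurable_itv _).
by congr seq_measurable; apply/seteqP; split => x /=; rewrite in_itv.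
Qed.

Section mixing.
Context (R : realType) d (T : measurableType d) (P : probability T R).
Variables (Fm Fp : R -> set (set T)).
Hypothesis Fm_sub : forall t, 0 <= t -> Fm t `<=` @measurable _ T.
Hypothesis Fp_sub : forall t, 0 <= t -> Fp t `<=` @measurable _ T.

(** The error is proportional to [pr P E].  Hence errors over the pieces of a
    partition of the past add up to a single mixing coefficient. *)
Lemma mixing_coefP (t s : R) (E F : set T) : 0 <= t -> 0 <= s ->
  Fm t E -> Fp (t + s) F ->
  `|pr P (F `&` E) - pr P F * pr P E| <= mixing_coef P Fm Fp s * pr P E.
Proof.
move=> t0 s0 FmE FpF.
have mE : measurable E by exact: Fm_sub FmE.
have mF : measurable F by apply: Fp_sub FpF; rewrite addr_ge0.
have mFE : measurable (F `&` E) by exact: measurableI.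
have := pr_ge0 P E; rewrite le_eqVlt => /predU1P[E0|E0].
  rewrite -E0 !mulr0 subr0 ger0_norm ?pr_ge0//.
  by rewrite E0; apply: pr_le => //; exact: subIsetr.
suff h : `|cond_prob P F E - pr P F| <= mixing_coef P Fm Fp s.
  rewrite -ler_pdivrMr// -[X in _ / X](gtr0_norm E0) -normf_div mulrBl.
  by rewrite mulfK ?gt_eqF.
apply: ub_le_sup; last first.
  exists t, E, F; split=> //; by rewrite measure_prE// lte_fin.
exists 1 => _ /= [t' [E' [F' [t'0 FmE' FpF' PE' ->]]]].
have mE' : measurable E' by exact: Fm_sub FmE'.
have mF' : measurable F' by apply: Fp_sub FpF'; rewrite addr_ge0.
have E'0 : 0 < pr P E' by rewrite -lte_fin -measure_prE.
have c0 : 0 <= cond_prob P F' E' by rewrite divr_ge0 ?pr_ge0.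
have c1 : cond_prob P F' E' <= 1.
  rewrite ler_pdivrMr// mul1r; apply: (pr_le P _ mE' (@subIsetr _ F' E')).
  exact: measurableI.
have p0 := pr_ge0 P F'; have p1 := pr_le1 P mF'.
by rewrite ler_norml; apply/andP; split; rewrite -/(pr P F'); lra.
Qed.

End mixing.

Lemma liminf_exists (R : realType) (z : nat -> R) (K : R) :
  (forall n, 0 <= z n <= K) ->
  exists l, [/\ 0 <= l <= K,
    forall e, 0 < e -> exists n0, forall n, (n0 <= n)%N -> l - e <= z n &
    forall e n0, 0 < e -> exists2 n, (n0 <= n)%N & z n <= l + e].
Proof.
move=> zK.
pose S := [set y | exists n0, forall n, (n0 <= n)%N -> y <= z n].
have S0 : S 0 by exists 0%N => n _; case/andP: (zK n).
have SK : ubound S K.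
  by move=> y [n0 h]; apply: le_trans (h n0 (leqnn _)) _; case/andP: (zK n0).
have hS : has_sup S by split; [exists 0|exists K].
exists (sup S); split.
- by rewrite ge_sup//= ?andbT; [rewrite ub_le_sup//; exists K|exists 0].
- move=> e e0; have [y [n0 yn] h] := sup_adherent e0 hS.
  by exists n0 => n /yn; apply: le_trans; exact: ltW.
- move=> e n0 e0; apply: contrapT => h.
  have : S (sup S + e).
    exists n0 => n n0n; rewrite leNgt; apply/negP => zn; apply: h.
    by exists n => //; exact: ltW.
  move=> /(ub_le_sup (ex_intro _ K SK)).
  by rewrite gerDl leNgt e0.
Qed.

Lemma pr_partition (R : realType) d (T : measurableType d) (P : probability T R)
    (n : nat) (s : T -> nat) (D : set T) :
  (forall w, (s w < n)%N) -> (forall i, measurable [set w | s w = i]) ->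
  measurable D ->
  pr P D = \sum_(i < n) pr P ([set w | s w = i] `&` D).
Proof.
move=> sn ms mD; have mI i : measurable ([set w | s w = i] `&` D).
  exact: measurableI.
rewrite -mean_indic//.
rewrite (eq_bigr (fun i : 'I_n => mean P \1_([set w | s w = i] `&` D))); last first.
  by move=> i _; rewrite mean_indic.
rewrite -mean_sum; last by move=> i; exact: bounded_rv_indic.
congr mean; apply/funext => w; rewrite (bigD1 (Ordinal (sn w)))//= big1 ?addr0.
  rewrite !indicE; congr (_%:R); congr nat_of_bool.
  by apply/idP/idP => [/set_mem Dw|/set_mem[_ Dw]]; apply/mem_set.
move=> i /eqP ni; rewrite indicE memNset// => -[/= sw _].
by apply: ni; exact/val_inj.
Qed.

Lemma pr_bigcup_approx (R : realType) d (T : measurableType d)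
    (P : probability T R) (F : nat -> set T) (e : R) :
  (forall n, measurable (F n)) -> nondecreasing_seq F -> 0 < e ->
  exists n, pr P (\bigcup_k F k) - e <= pr P (F n).
Proof.
move=> mF ndF e0; have mU : measurable (\bigcup_k F k) by exact: bigcup_measurable.
have : P (F n) @[n --> \oo] --> P (\bigcup_n F n).
  exact: nondecreasing_cvg_mu.
rewrite (measure_prE P mU) => /fine_cvgP[_] /cvgrPdist_le/(_ _ e0)[n _ /(_ n (leqnn _))/=].
rewrite -/(pr P (F n)) => h; exists n.
by move: h; rewrite ler_norml => /andP[_]; lra.
Qed.

(** * Passage times after rounding and waiting *)

Definition grid_count (R : realType) (delta x : R) : nat :=
  `|Num.ceil (x / delta)|%N.

Lemma grid_count_le (R : realType) (delta x : R) r : 0 < delta -> 0 <= x ->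
  (grid_count delta x <= r)%N = (x <= delta * r%:R).
Proof.
move=> d0 x0; rewrite /grid_count -lez_nat.
rewrite gez0_abs ?ceil_ge0; last by rewrite (lt_le_trans _ (divr_ge0 x0 (ltW d0))) ?ltrN10.
by rewrite ceil_le_int ler_pdivrMr// mulrC.
Qed.

Lemma grid_count_ge (R : realType) (delta x : R) : 0 < delta -> 0 <= x ->
  x <= delta * (grid_count delta x)%:R.
Proof. by move=> d0 x0; rewrite -grid_count_le. Qed.

Lemma grid_count_leD (R : realType) (delta x : R) : 0 < delta -> 0 <= x ->
  delta * (grid_count delta x)%:R <= x + delta.
Proof.
move=> d0 x0; case E : (grid_count delta x) => [|r].
  by rewrite mulr0 addr_ge0// ltW.
rewrite -natr1 mulrDr mulr1 lerD2r ltW// ltNge -grid_count_le//.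
by rewrite E ltnn.
Qed.

Section passage_times.
Context (R : realType) (d : measure_display) (Omega : measurableType d)
  (P : probability Omega R) (Fm Fp : R -> set (set Omega))
  (X : R -> nat -> nat -> Omega -> R) (C delta : R).
Hypothesis Fm_sigma : forall t, 0 <= t -> sigma_algebra setT (Fm t).
Hypothesis Fp_sigma : forall t, 0 <= t -> sigma_algebra setT (Fp t).
Hypothesis Fm_mono : forall s t, 0 <= s <= t -> Fm s `<=` Fm t.
Hypothesis Fm_sub : forall t, 0 <= t -> Fm t `<=` @measurable _ Omega.
Hypothesis Fp_sub : forall t, 0 <= t -> Fp t `<=` @measurable _ Omega.
Hypothesis X_ge0 : forall t m n w, 0 <= t -> (m < n)%N -> 0 <= X t m n w.
Hypothesis C_gt0 : 0 < C.
Hypothesis delta_gt0 : 0 < delta.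
Hypothesis X_first : forall w, X 0 0%N 1%N w <= C.
Hypothesis X_law : forall t t' m m', 0 <= t -> 0 <= t' ->
  same_joint_law P (fun i => X t m (m + i.+1)%N) (fun i => X t' m' (m' + i.+1)%N).
Hypothesis X_plus : forall t m n, 0 <= t -> (m < n)%N ->
  forall B : set R, measurable B -> Fp t (X t m n @^-1` B).
Hypothesis X_minus : forall t s m n, 0 <= t -> 0 <= s -> (m < n)%N ->
  Fm (t + s) [set w | X t m n w <= s].
Hypothesis mixing0 : mixing_coef P Fm Fp s @[s --> +oo] --> 0.
Hypothesis X_shift : forall t m n j w, 0 <= t -> (m < n)%N ->
  X t m n w <= X (t + C * j%:R) m n w + C * j%:R.
Hypothesis X_concat : forall t m k n j w r, 0 <= t -> (m < k)%N -> (k < n)%N ->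
  r = delta * (grid_count delta (X t m k w))%:R + C * j.+1%:R ->
  X t m n w <= r + X (t + r) k n w.

(* [X_shift] and [X_concat] are the forms in which the time shift bound and
   subadditivity are used; see [time_shift_iter] and [concat_after_wait]. *)
Let phi := mixing_coef P Fm Fp.

(** Everything that is used about a passage started from site [m] at time [t] is
    a [seq_measurable] event of this sequence: such an event lies in [Fp t], and
    its probability depends neither on [t] nor on [m]. *)
Definition profile t m w : nat -> R := fun i => X t m (m + i.+1)%N w.

(** The sets whose preimage lies in [Fp t] form a sigma-algebra containing the
    coordinate events. *)
Lemma profile_Fp t m B : 0 <= t -> seq_measurable B -> Fp t (profile t m @^-1` B).
Proof.
move=> t0; apply: (smallest_sub (X := fun B => Fp t (profile t m @^-1` B))).
  have sF := Fp_sigma t0; case: (sF) => F0 _ FU; split => //.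
    move=> A FA; rewrite setTD.
    exact: (sigma_setC sF FA).
  by move=> A FA; rewrite preimage_bigcup; exact: FU.
move=> _ [i _ [B' mB' <-]]; rewrite setTI.
by apply: (X_plus t0 _ mB'); lia.
Qed.

Lemma measurable_profile t m B : 0 <= t -> seq_measurable B ->
  measurable (profile t m @^-1` B).
Proof. by move=> t0 mB; apply: (Fp_sub t0); exact: (profile_Fp _ t0 mB). Qed.

Lemma profile_law t m B : 0 <= t -> seq_measurable B ->
  pr P (profile t m @^-1` B) = pr P (profile 0 0 @^-1` B).
Proof. by move=> t0 mB; rewrite /pr; congr fine; exact: X_law. Qed.

Lemma profile_mixing (s g : R) m E B : 0 <= s -> 0 <= g -> Fm s E ->
  seq_measurable B ->
  `|pr P (profile (s + g) m @^-1` B `&` E) - pr P (profile 0 0 @^-1` B) * pr P E|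
    <= phi g * pr P E.
Proof.
move=> s0 g0 FE mB; rewrite -(profile_law m (addr_ge0 s0 g0) mB).
apply: (mixing_coefP P Fm_sub Fp_sub s0 g0 FE).
exact: (profile_Fp _ (addr_ge0 s0 g0) mB).
Qed.

Lemma phi_small e : 0 < e -> exists s0, 0 <= s0 /\ forall s, s0 <= s -> phi s <= e.
Proof.
move=> e0; have /cvgrPdist_le/(_ _ e0)[M [_ hM]] := mixing0.
exists (`|M| + 1); split; first by rewrite addr_ge0.
move=> s Ms; have /hM : M < s.
  by apply: lt_le_trans Ms; rewrite (le_lt_trans (ler_norm _))// ltrDl.
by rewrite sub0r normrN; apply: le_trans; exact: ler_norm.
Qed.

Lemma gap_exists e : 0 < e -> exists g : nat, phi (C * g.+1%:R) <= e.
Proof.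
move=> /phi_small[s0 [s00 hs]]; exists (Num.truncn (s0 / C)); apply: hs.
by rewrite mulrC -ler_pdivrMr//; exact/ltW/truncnS_gt.
Qed.

(** The times at which a passage can start, after [i] steps of the mesh and [j]
    waits. *)
Definition grid (i j : nat) : R := delta * i%:R + C * j%:R.

Lemma grid_ge0 i j : 0 <= grid i j.
Proof. by rewrite addr_ge0// mulr_ge0// ltW. Qed.

Lemma gridD i j i' j' : grid (i + i') (j + j') = grid i j + grid i' j'.
Proof. by rewrite /grid !natrD; ring. Qed.

Lemma grid0 j : grid 0 j = C * j%:R. Proof. by rewrite /grid mulr0 add0r. Qed.

(** One site costs a passage of at most [C], the rounding [delta] and a wait [C];
    [kappa] converts this cost into a number of steps of the mesh. *)
Definition kappa : nat := (Num.truncn ((2 * C + delta) / delta)).+1.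
Definition unit_cost : R := delta * kappa%:R.

Lemma unit_cost_ge : 2 * C + delta <= unit_cost.
Proof. by rewrite /unit_cost /kappa [leRHS]mulrC -ler_pdivrMr//; exact/ltW/truncnS_gt. Qed.

Lemma unit_cost_gt0 : 0 < unit_cost.
Proof. by have := unit_cost_ge; have := C_gt0; have := delta_gt0; lra. Qed.

(** The bound on one-site passages transfers from the origin to every site and
    time only almost surely; an intersection over the countable grid still has
    probability 1, and it contains all the times that are used. *)
Definition tame : set Omega :=
  \bigcap_i \bigcap_j \bigcap_m [set w | X (grid i j) m m.+1 w <= C].

Lemma tame_step i j m : measurable [set w | X (grid i j) m m.+1 w <= C] /\
  P (~` [set w | X (grid i j) m m.+1 w <= C]) = 0%E.
Proof.
have eqp t k : [set w | X t k k.+1 w <= C] = profile t k @^-1` [set x | x 0%N <= C].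
  by apply/seteqP; split=> w; rewrite /profile/= addn1.
have mB := seq_measurable_le 0 C.
have g0 := grid_ge0 i j.
have mS : measurable [set w | X (grid i j) m m.+1 w <= C].
  by rewrite eqp; exact: measurable_profile.
split=> //; rewrite measure_prE ?prC//; last exact: measurableC.
rewrite eqp profile_law// -eqp (_ : [set w | _] = setT) ?prT ?subrr//.
by apply/seteqP; split=> w //= _; exact: X_first.
Qed.

Lemma measurable_tame : measurable tame.
Proof.
apply: bigcap_measurable => // i _; apply: bigcap_measurable => // j _.
by apply: bigcap_measurable => // m _; have [] := tame_step i j m.
Qed.

Lemma tame_as : P (~` tame) = 0%E.
Proof.
apply/negligibleP; first exact: measurableC measurable_tame.
rewrite setC_bigcap bigcup_mkcond; apply: negligible_bigcup => i.
rewrite mem_setT setC_bigcap bigcup_mkcond; apply: negligible_bigcup => j.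
rewrite mem_setT setC_bigcap bigcup_mkcond; apply: negligible_bigcup => m.
rewrite mem_setT; have [mS PS] := tame_step i j m.
by apply/negligibleP => //; exact: measurableC.
Qed.

Lemma tame_ae : {ae P, forall w, tame w}.
Proof.
exists (~` tame); split; [exact: measurableC measurable_tame|exact: tame_as|].
by move=> w.
Qed.

Lemma concat_grid i j j' m k n w N : (m < k)%N -> (k < n)%N ->
  N = grid_count delta (X (grid i j) m k w) ->
  X (grid i j) m n w <= grid N j'.+1 + X (grid (i + N) (j + j'.+1)) k n w.
Proof.
move=> mk kn ->; rewrite gridD.
exact: (X_concat (j := j') (grid_ge0 i j) mk kn).
Qed.

Lemma tame_bound w i j m n : tame w ->
  X (grid i j) m (m + n.+1) w <= unit_cost * n.+1%:R.
Proof.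
move=> sw; elim: n i j m => [|n IHn] i j m.
  rewrite addn1 mulr1; apply: (@le_trans _ _ C); first exact: sw.
  by have := unit_cost_ge; have := C_gt0; have := delta_gt0; lra.
have mm : (m < m.+1)%N by [].
have mn : (m.+1 < m + n.+2)%N by lia.
apply: le_trans (concat_grid 0 mm mn erefl) _.
set N := grid_count _ _.
have XC : X (grid i j) m m.+1 w <= C by exact: sw.
have := IHn (i + N)%N (j + 1)%N m.+1.
have -> : (m.+1 + n.+1 = m + n.+2)%N by lia.
have := grid_count_leD delta_gt0 (X_ge0 w (grid_ge0 i j) mm); rewrite -/N.
have := unit_cost_ge; move: XC.
set Y := X _ _ m.+1 _; set Z := X _ _ _ _.
by rewrite -(natr1 n.+1) /grid [unit_cost * (_ + _)]mulrDr !mulr1; lra.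
Qed.

(** The rounded passage time, capped at a value that is not exceeded on [tame].
    The cap makes it bounded for every [w] without affecting its measurability
    with respect to [Fm] and [Fp]. *)
Definition steps t m n w : nat :=
  minn (grid_count delta (X t m n w)) ((n - m) * kappa).

Lemma steps_le t m n w : (steps t m n w <= (n - m) * kappa)%N.
Proof. exact: geq_minr. Qed.

Lemma tame_steps w i j m n : tame w -> (m < n)%N ->
  steps (grid i j) m n w = grid_count delta (X (grid i j) m n w).
Proof.
move=> sw mn; apply/minn_idPl; rewrite grid_count_le ?X_ge0 ?grid_ge0//.
rewrite natrM mulrCA mulrC -/unit_cost.
have /(tame_bound i j m) := sw => /(_ (n - m).-1).
by rewrite prednK ?subn_gt0// subnKC// ltnW.
Qed.

Definition count_above (n u : nat) : set (nat -> R) :=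
  [set x | (u < n.+1 * kappa)%N /\ delta * u%:R < x n].

Lemma seq_measurable_count_above n u : seq_measurable (count_above n u).
Proof.
have sS := @smallest_sigma_algebra _ setT
  (\bigcup_i preimage_set_system setT (fun x : nat -> R => x i) (@measurable _ R)).
have [un|un] := boolP (u < n.+1 * kappa)%N; last first.
  rewrite (_ : count_above n u = set0); first by case: sS.
  by apply/seteqP; split=> x // -[h _]; rewrite h in un.
have := seq_measurable_le n (delta * u%:R) => /(sigma_setC sS).
congr seq_measurable; apply/seteqP; split=> x /=.
  by move/negP; rewrite -ltNge.
by move=> [_ h]; apply/negP; rewrite -ltNge.
Qed.

(** Writing the tail events of [steps] as events of the profile gives at once
    their [Fp]-measurability and the invariance of their probability. *)
Lemma steps_gtE t m n u : 0 <= t ->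
  [set w | (u < steps t m (m + n.+1) w)%N] = profile t m @^-1` count_above n u.
Proof.
move=> t0; have X0 w : 0 <= X t m (m + n.+1) w by apply: X_ge0 => //; lia.
apply/seteqP; split=> w; rewrite /= /count_above /profile/= /steps addKn.
  rewrite leq_min => /andP[h ->]; split=> //.
  by rewrite ltNge -grid_count_le// -ltnNge.
move=> [un h]; rewrite leq_min un andbT.
by rewrite ltnNge grid_count_le// -ltNge.
Qed.

Lemma steps_Fm_le t m n r : 0 <= t -> (m < n)%N ->
  Fm (t + delta * r%:R) [set w | (steps t m n w <= r)%N].
Proof.
move=> t0 mn; have r0 : 0 <= delta * r%:R by rewrite mulr_ge0// ltW.
have sF := Fm_sigma (addr_ge0 t0 r0).
have [nr|rn] := leqP ((n - m) * kappa) r.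
  rewrite (_ : [set w | _] = setT); first exact: sigma_setT.
  by apply/seteqP; split=> w //= _; apply: leq_trans (steps_le _ _ _ _) nr.
rewrite (_ : [set w | _] = [set w | X t m n w <= delta * r%:R]).
  exact: X_minus.
apply/seteqP; split=> w /=; rewrite -grid_count_le ?X_ge0// /steps geq_min.
  by rewrite (leqNgt (_ * _) r) rn orbF.
by move->.
Qed.

Lemma steps_Fm t m n r : 0 <= t -> (m < n)%N ->
  Fm (t + delta * r%:R) [set w | steps t m n w = r].
Proof.
move=> t0 mn; have r0 : 0 <= delta * r%:R by rewrite mulr_ge0// ltW.
have sF := Fm_sigma (addr_ge0 t0 r0).
case: r => [|r] in r0 sF *.
  rewrite (_ : [set w | _] = [set w | (steps t m n w <= 0)%N]).
    exact: steps_Fm_le.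
  by apply/seteqP; split=> w /=; rewrite leqn0 => /eqP.
rewrite (_ : [set w | _] = [set w | (steps t m n w <= r.+1)%N] `&`
                           ~` [set w | (steps t m n w <= r)%N]).
  apply: sigma_setI => //; first exact: steps_Fm_le.
  apply: sigma_setC => //; apply: (Fm_mono _ (steps_Fm_le r t0 mn)).
  rewrite addr_ge0//=; last by rewrite mulr_ge0// ltW.
  by rewrite lerD2l ler_wpM2l ?ler_nat// ltW.
apply/seteqP; split=> w /= => [->|[h /negP]]; first by split=> //; rewrite ltnn.
by rewrite -ltnNge => h'; apply/eqP; rewrite eqn_leq h h'.
Qed.

Lemma measurable_steps_gt t m n u : 0 <= t -> (m < n)%N ->
  measurable [set w | (u < steps t m n w)%N].
Proof.
move=> t0 mn; rewrite -(subnKC (ltnW mn)) -(prednK (n := n - m)%N) ?subn_gt0//.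
by rewrite steps_gtE//; apply: measurable_profile => //; exact: seq_measurable_count_above.
Qed.

Lemma measurable_steps t m n r : 0 <= t -> (m < n)%N ->
  measurable [set w | steps t m n w = r].
Proof.
move=> t0 mn; apply: (Fm_sub _ (steps_Fm r t0 mn)).
by rewrite addr_ge0// mulr_ge0// ltW.
Qed.

Definition mean_steps n : R := mean P (fun w => (steps 0 0%N n w)%:R).

Lemma steps_sum_indic n : (fun w => (steps 0 0%N n w)%:R : R) =
  (fun w => \sum_(u < n * kappa) \1_[set w | (u < steps 0 0%N n w)%N] w).
Proof.
apply/funext => w; rewrite (nat_sum_ltn R (M := n * kappa)).
  by apply: eq_bigr => u _; rewrite indicE mem_setE.
by rewrite -[X in (_ <= X * _)%N]subn0 steps_le.
Qed.

Lemma bounded_steps n : (0 < n)%N -> bounded_rv (fun w => (steps 0 0%N n w)%:R : R).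
Proof.
move=> n0; rewrite steps_sum_indic.
by apply: bounded_rv_sum => u; apply: bounded_rv_indic; exact: measurable_steps_gt.
Qed.

Lemma mean_stepsE n : (0 < n)%N ->
  mean_steps n = \sum_(u < n * kappa) pr P [set w | (u < steps 0 0%N n w)%N].
Proof.
move=> n0; rewrite /mean_steps steps_sum_indic mean_sum; last first.
  by move=> u; apply: bounded_rv_indic; exact: measurable_steps_gt.
by apply: eq_bigr => u _; rewrite mean_indic//; exact: measurable_steps_gt.
Qed.

(** * The upper bound: a chain of blocks *)

(** The rounded duration of the [k]-th block of [m] sites when the blocks before
    it took [i] steps of the mesh and each block, the first one included, is
    preceded by a wait [C * g]. *)
Definition block m g k i w : nat :=
  steps (grid i (k.+1 * g)) (k * m) (k.+1 * m) w.

Fixpoint chain m g k w : nat :=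
  if k is k'.+1 then (chain m g k' w + block m g k' (chain m g k' w) w)%N
  else 0%N.

(** The first [k] blocks and the [k] waits before them are over at time
    [grid i (k * g)]; the next block starts only after one more wait. *)
Lemma chain_Fm m g k i : (0 < m)%N ->
  Fm (grid i (k * g)) [set w | chain m g k w = i].
Proof.
move=> m0; elim: k i => [|k IHk] i.
  case: (Fm_sigma (grid_ge0 i (0 * g))) => F0 _ _.
  case: i F0 => [|i] F0 /=.
    rewrite (_ : [set w | _] = setT); first exact: (sigma_setT (Fm_sigma (grid_ge0 _ _))).
    by apply/seteqP; split.
  by rewrite (_ : [set w | _] = set0)//; apply/seteqP; split.
have -> : [set w | chain m g k.+1 w = i] = \bigcup_(i' in [set i' | (i' <= i)%N])
    ([set w | chain m g k w = i'] `&` [set w | block m g k i' w = (i - i')%N]).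
  apply/seteqP; split => [w /= <-|w [i' /= i'i [-> ->]]]; last by rewrite subnKC.
  by exists (chain m g k w); rewrite /= ?leq_addr// addKn.
have sF := Fm_sigma (grid_ge0 i (k.+1 * g)).
apply: sigma_bigcup => // i' /= i'i; apply: sigma_setI => //.
  apply: (Fm_mono _ (IHk i')); rewrite grid_ge0/= /grid.
  by apply: lerD; rewrite ler_wpM2l ?ler_nat// ?ltW// leq_mul2r leqnSn orbT.
have kk : (k * m < k.+1 * m)%N by rewrite ltn_mul2r m0 ltnSn.
have -> : grid i (k.+1 * g) = grid i' (k.+1 * g) + delta * (i - i')%:R.
  by rewrite /grid addrAC -mulrDr -natrD subnKC.
exact: (steps_Fm _ (grid_ge0 _ _) kk).
Qed.

Lemma measurable_chain m g k i : (0 < m)%N ->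
  measurable [set w | chain m g k w = i].
Proof. by move=> m0; apply: (Fm_sub (grid_ge0 i (k * g))); exact: chain_Fm. Qed.

(** The wait before the first block is paid for by [X_shift], each later one by
    [X_concat]. *)
Lemma chain_bound w m g k n : tame w -> (0 < m)%N -> (k * m < n)%N ->
  X 0 0%N n w <= grid (chain m g.+1 k w) (k.+1 * g.+1)
    + X (grid (chain m g.+1 k w) (k.+1 * g.+1)) (k * m) n w.
Proof.
move=> sw m0; elim: k => [|k IHk] kn.
  by have := @X_shift 0 _ _ g.+1 w (lexx 0) kn; rewrite add0r mul1n grid0 addrC.
have kk : (k * m < k.+1 * m)%N by rewrite ltn_mul2r m0 ltnSn.
apply: le_trans (IHk (ltn_trans kk kn)) _.
apply: le_trans (lerD (lexx _) (concat_grid g kk kn erefl)) _.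
rewrite addrA -gridD /= /block -tame_steps//.
by rewrite [in X in _ <= X](_ : k.+2 * g.+1 = k.+1 * g.+1 + g.+1)%N// mulSn addnC.
Qed.

Lemma steps_mixing (s g : R) m n u E : 0 <= s -> 0 <= g -> (0 < n)%N -> Fm s E ->
  pr P (E `&` [set w | (u < steps (s + g) m (m + n) w)%N])
  <= (pr P [set w | (u < steps 0 0%N n w)%N] + phi g) * pr P E.
Proof.
case: n => // n s0 g0 _ FE; rewrite -[n.+1 in leRHS]add0n !steps_gtE ?addr_ge0// setIC mulrDl.
have := profile_mixing m s0 g0 FE (seq_measurable_count_above n u).
by rewrite ler_norml => /andP[_]; rewrite lerBlDl.
Qed.

(** The conditional mean of a block, written as a sum of tail probabilities,
    exceeds the mean of [steps] by one mixing coefficient per possible value. *)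
Lemma block_mixing m g k i : (0 < m)%N ->
  \sum_(u < m * kappa) pr P ([set w | chain m g k w = i] `&`
                             [set w | (u < block m g k i w)%N])
  <= (m * kappa)%:R * (mean_steps m / (m * kappa)%:R + phi (C * g%:R))
     * pr P [set w | chain m g k w = i].
Proof.
move=> m0; have M0 : (m * kappa)%:R != 0 :> R by rewrite pnatr_eq0 -lt0n muln_gt0 m0.
rewrite mulrDr mulrCA mulfV// mulr1 mean_stepsE//.
have -> : (m * kappa)%:R * phi (C * g%:R) = \sum_(u < m * kappa) phi (C * g%:R).
  by rewrite sumr_const card_ord mulr_natl.
rewrite -big_split mulr_suml; apply: ler_sum => u _ /=.
have Cg0 : 0 <= C * g%:R by rewrite mulr_ge0// ltW.
have := steps_mixing (k * m) u (grid_ge0 i (k * g)) Cg0 m0 (chain_Fm g k i m0).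
rewrite /block -(grid0 g) -gridD addn0 mulSn addnC.
by rewrite [(k * m + m)%N]addnC -mulSn.
Qed.

(** The waits are negligible because the block is long compared with the gap
    [C * g.+1], and the mixing error because [unit_cost * phi] at that gap is at
    most [e / 6]. *)
Lemma upper_as (l e : R) : 0 <= l -> 0 < e ->
  (forall e' n0, 0 < e' -> exists2 n, (n0 <= n)%N &
     delta * mean_steps n / n%:R <= l + e') ->
  {ae P, forall w, exists n0, forall n, (n0 <= n)%N ->
     X 0 0%N n w <= (l + e) * n%:R}.
Proof.
move=> l0 e0 freq.
have K0 := unit_cost_gt0.
(* With this [eta], the mixing error and the Chernoff margin cost [e / 6] per
   site each. *)
pose eta := e / (6 * unit_cost).
have eta0 : 0 < eta by rewrite divr_gt0// mulr_gt0.
have [g hg] := gap_exists eta0.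
set f := phi _ in hg.
have e60 : 0 < e / 6 by rewrite divr_gt0.
have [m hm zm] := freq _ (Num.truncn (6 * C * g.+1%:R / e)).+1 e60.
have m0 : (0 < m)%N by apply: leq_trans hm.
have mp : 0 < m%:R :> R by rewrite ltr0n.
have gm : C * g.+1%:R <= e / 6 * m%:R.
  have : 6 * C * g.+1%:R / e <= m%:R.
    by apply: le_trans (ltW (truncnS_gt _)) _; rewrite ler_nat.
  by rewrite ler_pdivrMr// => h; rewrite mulrAC ler_pdivlMr//; lra.
pose M := (m * kappa)%N.
have M0 : (0 < M)%N by rewrite muln_gt0 m0.
pose beta := mean_steps m / M%:R + f.
pose x := beta + eta.
pose lam := Num.min 2^-1 (eta / 4).
have lam0 : 0 < lam by rewrite /lam lt_min invr_gt0 ltr0n/= divr_gt0.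
have lam2 : lam <= 2^-1 by rewrite /lam ge_min lexx.
have lam4 : lam <= eta / 4 by rewrite /lam ge_min lexx orbT.
(* The exponent is [lam * (2 * lam - eta)], hence the choice of [lam]. *)
pose r := expR (lam * beta + 2 * lam ^+ 2 - lam * x).
have r01 : 0 < r < 1.
  rewrite expR_gt0/= -expR0 ltr_expR /x.
  have -> : lam * beta + 2 * lam ^+ 2 - lam * (beta + eta) = lam * (2 * lam - eta).
    by ring.
  by rewrite pmulr_rlt0//; lra.
pose F q := [set w | x * M%:R * q%:R <= (chain m g.+1 q w)%:R].
have mF q : measurable (F q).
  have -> : F q = \bigcup_(i in [set i | x * M%:R * q%:R <= i%:R])
                  [set w | chain m g.+1 q w = i].
    apply/seteqP; split=> [w Fw|w [i xi swi]]; first by exists (chain m g.+1 q w).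
    by rewrite /F /= (swi : _ = i).
  by apply: bigcup_measurable => i _; exact: measurable_chain.
have hF q : pr P (F q) <= r ^+ q.
  apply: (@chernoff_adapted_sum R _ Omega P M (block m g.+1)) => //.
  - move=> k i w; apply: leq_trans (steps_le _ _ _ _) _.
    by rewrite mulSn addnK.
  - move=> k i u; apply: measurable_steps_gt; first exact: grid_ge0.
    by rewrite ltn_mul2r m0 ltnSn.
  - by move=> k i; exact: measurable_chain.
  - by move=> k i; exact: block_mixing.
  - by rewrite (ltW lam0) lam2.
have := borel_cantelli_geometric r01 mF hF.
apply: filterS2 tame_ae => w sw [q0 hq].
pose D := C * g.+1%:R + unit_cost * m%:R.
pose n0 := (Num.truncn (6 * D / e)).+1.
exists (maxn n0 (q0 * m).+1) => n; rewrite geq_max => /andP[n0n qn].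
(* The predecessor leaves a nonempty remainder [q * m < n] for the last,
   incomplete block. *)
pose q := (n.-1 %/ m)%N.
have n_gt0 : (0 < n)%N by exact: leq_ltn_trans qn.
have qmn : (q * m < n)%N by rewrite -[ltnRHS](prednK n_gt0) ltnS leq_trunc_div.
have q0q : (q0 <= q)%N by rewrite leq_divRL// -ltnS (prednK n_gt0).
have nqm : (n <= q * m + m)%N.
  by rewrite -[leqLHS](prednK n_gt0) {1}(divn_eq n.-1 m) -addnS leq_add2l ltn_mod.
have := hq _ q0q; rewrite /F/= => /negP; rewrite -ltNge => hs.
have h1 := chain_bound g sw m0 qmn.
have h2 : X (grid (chain m g.+1 q w) (q.+1 * g.+1)) (q * m) n w <= unit_cost * m%:R.
  have := tame_bound (chain m g.+1 q w) (q.+1 * g.+1) (q * m) (n - q * m).-1 sw.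
  rewrite prednK ?subn_gt0// subnKC; last exact: ltnW.
  move/le_trans; apply; rewrite ler_wpM2l ?ler_nat ?(ltW K0)//.
  by rewrite leq_subLR.
apply: (le_trans h1); apply: (le_trans (lerD (lexx _) h2)).
set S := chain m g.+1 q w in hs *.
have Dn : D <= e / 6 * n%:R.
  have : 6 * D / e <= n%:R.
    by apply: le_trans (ltW (truncnS_gt _)) _; rewrite ler_nat.
  by rewrite ler_pdivrMr// => h; rewrite mulrAC ler_pdivlMr//; lra.
have qn' : q%:R * m%:R <= n%:R :> R by rewrite -natrM ler_nat ltnW.
have hb : delta * mean_steps m <= (l + e / 6) * m%:R by rewrite -ler_pdivrMr.
have hdM : delta * M%:R = unit_cost * m%:R by rewrite /M natrM /unit_cost; ring.
have heta : unit_cost * eta = e / 6.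
  by rewrite /eta; field; rewrite gt_eqF.
have hf : unit_cost * f <= e / 6 by rewrite -heta ler_wpM2l// ltW.
have hxM : delta * (x * M%:R) <= (l + e / 2) * m%:R.
  have -> : delta * (x * M%:R) =
      delta * mean_steps m + (unit_cost * f + unit_cost * eta) * m%:R.
    have Mn0 : M%:R != 0 :> R by rewrite pnatr_eq0 -lt0n.
    have -> : x * M%:R = mean_steps m + (f + eta) * M%:R.
      by rewrite /x /beta; field.
    by rewrite mulrDr mulrCA hdM; ring.
  rewrite heta; apply: (@le_trans _ _ ((l + e / 6) * m%:R + (e / 6 + e / 6) * m%:R)).
    by rewrite lerD// ler_wpM2r// lerD2r.
  by rewrite -mulrDl ler_wpM2r//; lra.
have hS : delta * S%:R <= (l + e / 2) * (q%:R * m%:R).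
  rewrite mulrA mulrAC; apply: le_trans (ler_wpM2r _ hxM); last exact: ler0n.
  by rewrite -mulrA ler_pM2l// ltW.
have hC : C * (q.+1 * g.+1)%:R <= C * g.+1%:R + e / 6 * (q%:R * m%:R).
  rewrite natrM -natr1 mulrDl mul1r mulrDr addrC lerD2l.
  by rewrite mulrCA [leRHS]mulrCA ler_wpM2l.
have hq0 : 0 <= q%:R * m%:R :> R by rewrite mulr_ge0.
have le0 : 0 <= l + 2 / 3 * e by lra.
have en0 : 0 <= e * n%:R by rewrite mulr_ge0// ltW.
have := ler_wpM2l le0 qn'; rewrite /D in Dn; rewrite /grid; lra.
Qed.

(** * The lower bound: a zero-one law and a covering *)

(** Coordinate [n] of a profile belongs to the site [n.+1]. *)
Definition dips th L (D : set nat) : set (nat -> R) :=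
  \bigcup_(n in D) [set x | x n <= th * n.+1%:R - L].

(** Subtracting every constant [L], instead of taking a lower limit of ratios,
    makes this event insensitive to a bounded change of the sequence. *)
Definition deep_dips th : set (nat -> R) :=
  \bigcap_(L in [set: nat]) dips th L%:R setT.

Lemma seq_sigma : sigma_algebra setT (@seq_measurable R).
Proof. exact: smallest_sigma_algebra. Qed.

Lemma seq_measurable_dips th L D : seq_measurable (dips th L D).
Proof.
by apply: (sigma_bigcup seq_sigma) => n _; exact: seq_measurable_le.
Qed.

Lemma seq_measurable_deep_dips th : seq_measurable (deep_dips th).
Proof.
by apply: (sigma_bigcap seq_sigma) => L _; exact: seq_measurable_dips.
Qed.

(** A passage that dips below the line takes at most [unit_cost * B], so the
    dip is observed by that time. *)
Lemma dips_Fm th L B : th <= unit_cost -> 0 <= L ->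
  Fm (unit_cost * B%:R) (profile 0 0 @^-1` dips th L `I_B).
Proof.
move=> thK L0; have K0 := unit_cost_gt0.
have KB : 0 <= unit_cost * B%:R by rewrite mulr_ge0// ltW.
rewrite preimage_bigcup; apply: sigma_bigcup; first exact: Fm_sigma.
move=> n /= nB; have [a0|a0] := leP 0 (th * n.+1%:R - L).
  apply: (Fm_mono _ (X_minus (lexx 0) a0 (ltn0Sn n))).
  rewrite add0r a0/= lerBlDr ler_wpDr//.
  by apply: (@le_trans _ _ (unit_cost * n.+1%:R)); rewrite ?ler_wpM2r// ler_wpM2l ?ler_nat// ltW.
rewrite (_ : _ @^-1` _ = set0); first by case: (Fm_sigma KB).
apply/seteqP; split=> // w /=; rewrite /profile/= => h.
by have := X_ge0 w (lexx 0) (ltn0Sn n); rewrite leNgt (le_lt_trans h a0).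
Qed.

Lemma deep_dips_shift th j :
  profile (C * j%:R) 0 @^-1` deep_dips th `<=` profile 0 0 @^-1` deep_dips th.
Proof.
have Cj : 0 <= C * j%:R by rewrite mulr_ge0// ltW.
move=> w h L _; have [n _ /= hn] := h (L + (Num.truncn (C * j%:R)).+1)%N I.
exists n => //=; have := @X_shift 0 0 (0 + n.+1)%N j w (lexx 0) (ltn0Sn n).
rewrite add0r => hs; apply: (le_trans hs); move: hn; rewrite /profile natrD.
have := truncnS_gt (C * j%:R); set Y := X _ _ _ _; lra.
Qed.

(** The event [deep_dips] for the passage delayed by [C * j] is contained in the
    undelayed one and equiprobable to it, so both agree almost surely.  For large
    [j] the delayed one is almost independent of [dips] within [B] sites. *)
Lemma deep_dips_indep th L B : th <= unit_cost ->
  pr P (profile 0 0 @^-1` deep_dips th `&` profile 0 0 @^-1` dips th L%:R `I_B)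
  = pr P (profile 0 0 @^-1` deep_dips th) * pr P (profile 0 0 @^-1` dips th L%:R `I_B).
Proof.
move=> thK.
have mI := seq_measurable_deep_dips th.
have mV := measurable_profile 0 (lexx 0) mI.
have mE := measurable_profile 0 (lexx 0) (seq_measurable_dips th L%:R `I_B).
have FE := dips_Fm B thK (ler0n R L).
set V := profile 0 0 @^-1` _ in mV *; set E := profile 0 0 @^-1` _ in mE FE *.
have KB : 0 <= unit_cost * B%:R by rewrite mulr_ge0// ltW// unit_cost_gt0.
apply/eqP; rewrite -subr_eq0 -normr_le0; apply/ler_addgt0Pr => e e0; rewrite add0r.
have [s0 [s00 hs0]] := phi_small e0.
pose j := (Num.truncn ((unit_cost * B%:R + s0) / C)).+1.
have hj : unit_cost * B%:R + s0 <= C * j%:R.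
  by rewrite [leRHS]mulrC -ler_pdivrMr//; exact/ltW/truncnS_gt.
have g0 : 0 <= C * j%:R - unit_cost * B%:R by lra.
have hg : s0 <= C * j%:R - unit_cost * B%:R by lra.
have := profile_mixing 0 KB g0 FE mI; rewrite [unit_cost * _ + _]addrC subrK.
have Cj : 0 <= C * j%:R by rewrite mulr_ge0// ltW.
have mVj := measurable_profile 0 Cj mI.
have VjV := @deep_dips_shift th j.
have prVj := profile_law 0 Cj mI.
set Vj := profile _ _ @^-1` _ in mVj VjV prVj *; rewrite -/V in VjV prVj *.
have V0 := pr_setDeq0 mV mVj VjV (esym prVj).
have mVE : measurable (V `&` E) by exact: measurableI.
have -> : pr P (Vj `&` E) = pr P (V `&` E).
  rewrite (pr_setID P mVE mVj) setIAC (setIidr VjV) -[LHS]addr0; congr (_ + _).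
  apply/eqP; rewrite eq_le pr_ge0 -V0/=; apply: pr_le.
  - by apply: measurableI => //; exact: measurableC.
  - by apply: measurableI => //; exact: measurableC.
  - by move=> w [[]].
move/le_trans; apply; apply: le_trans (ler_wpM2r (pr_ge0 P E) (hs0 _ hg)) _.
by rewrite ler_piMr ?(ltW e0)// pr_le1.
Qed.

(** Events independent of one of positive probability and increasing to a set
    that contains it have probabilities tending to 1. *)
Lemma dips_likely th (L : nat) eta : th <= unit_cost -> 0 < eta ->
  pr P (profile 0 0 @^-1` deep_dips th) != 0 ->
  exists B, 1 - eta <= pr P (profile 0 0 @^-1` dips th L%:R `I_B).
Proof.
move=> thK eta0 v0.
have mV := measurable_profile 0 (lexx 0) (seq_measurable_deep_dips th).
set v := pr _ _ in v0; have vp : 0 < v by rewrite lt_neqAle eq_sym v0 pr_ge0.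
pose E B := profile 0 0 @^-1` dips th L%:R `I_B.
have mE B : measurable (E B).
  exact: (measurable_profile _ (lexx 0) (seq_measurable_dips _ _ _)).
have ndE : nondecreasing_seq E.
  move=> a b ab; apply/subsetPset => w [n /= na h]; exists n => //=.
  exact: leq_trans ab.
have [B hB] := pr_bigcup_approx P mE ndE (mulr_gt0 eta0 vp).
exists B; rewrite -/(E B).
have mU : measurable (\bigcup_k E k) by exact: bigcup_measurable.
set V := profile 0 0 @^-1` deep_dips th in mV.
have VU : V `<=` \bigcup_k E k.
  by move=> w /(_ L I)[n _ h]; exists n.+1 => //; exists n => /=.
have EU : E B `<=` \bigcup_k E k by move=> w h; exists B.
have h1 : v * pr P (E B) = pr P (V `&` E B) by rewrite deep_dips_indep.
have := pr_setID P mV (mE B); rewrite -/v -h1 => h2.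
have h3 := pr_setID P mU (mE B); rewrite setIC (setIidl EU) in h3.
have h4 : pr P (V `&` ~` E B) <= pr P (\bigcup_k E k `&` ~` E B).
  apply: pr_le; try (by apply: measurableI => //; exact: measurableC).
  by move=> w [/VU].
by rewrite -(ler_pM2l vp); lra.
Qed.

(** [eta] bounds both the probability that the origin has no dip within [B] sites
    and the mixing error; bad sites then cost at most [e / 4] per site.  The depth
    [L] of the dips absorbs the rounding and the wait. *)
Lemma lower_null (l th : R) : th < l -> l <= unit_cost ->
  (forall e, 0 < e -> exists n0, forall n, (n0 <= n)%N ->
     l - e <= delta * mean_steps n / n%:R) ->
  pr P (profile 0 0 @^-1` deep_dips th) = 0.
Proof.
move=> thl lK freq; apply/eqP; apply/negP => /negP v0.
have K0 := unit_cost_gt0.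
have thK : th <= unit_cost by apply: ltW; exact: lt_le_trans lK.
pose e := l - th; have e0 : 0 < e by rewrite subr_gt0.
have Kth : 0 < unit_cost - th by rewrite subr_gt0 (lt_le_trans thl).
pose eta := e / (8 * (unit_cost - th)).
have eta0 : 0 < eta by rewrite divr_gt0// mulr_gt0.
have [g hg] := gap_exists eta0; set f := phi _ in hg.
pose L := (Num.truncn (delta + C * g.+1%:R)).+1.
have hL : delta + C * g.+1%:R <= L%:R by exact/ltW/truncnS_gt.
have [B hB] := dips_likely L thK eta0 v0.
pose E t m := profile t m @^-1` dips th L%:R `I_B.
have mLow := seq_measurable_dips th L%:R `I_B.
have mE t m : 0 <= t -> measurable (E t m) by move=> t0; exact: measurable_profile.
pose S u w := steps 0 0%N u w.
pose Gi u i := [set w | S u w = i] `&` ~` E (grid i g.+1) u.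
pose G u := \bigcup_i Gi u i.
have mS u i : (0 < u)%N -> measurable [set w | S u w = i].
  by move=> u0; exact: measurable_steps.
have mGi u i : (0 < u)%N -> measurable (Gi u i).
  move=> u0; apply: measurableI; first exact: mS.
  by apply: measurableC; apply: mE; exact: grid_ge0.
have mG u : (0 < u)%N -> measurable (G u).
  by move=> u0; apply: bigcup_measurable => i _; exact: mGi.
have Su u w : (S u w < (u * kappa).+1)%N.
  by rewrite ltnS -[X in (_ <= X * _)%N]subn0 steps_le.
have Cg0 : 0 <= C * g.+1%:R by rewrite mulr_ge0// ltW.
have prG u : (0 < u)%N -> pr P (G u) <= eta + f.
  move=> u0; rewrite (pr_partition P (Su u) _ (mG u u0)); last by move=> i; exact: mS.
  apply: (@le_trans _ _ (\sum_(i < (u * kappa).+1) (eta + f) * pr P [set w | S u w = i])).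
    apply: ler_sum => i _.
    have -> : [set w | S u w = i] `&` G u = Gi u i.
      apply/seteqP; split=> w; first by move=> [/= <-] [k _ [/= <-]].
      by move=> [swi h]; split=> //; exists i.
    have FS : Fm (grid i 0) [set w | S u w = i].
      have := steps_Fm (nat_of_ord i) (lexx 0) u0.
      by rewrite /grid mulr0 addr0 add0r.
    have := profile_mixing u (grid_ge0 i 0) Cg0 FS mLow.
    rewrite -(grid0 g.+1) -gridD addn0 add0n -/(E (grid i g.+1) u) ler_norml => /andP[h _].
    have := pr_setID P (mS u i u0) (mE _ u (grid_ge0 i g.+1)).
    rewrite -/(Gi u i) => h2.
    have p0 := pr_ge0 P [set w | S u w = i].
    rewrite [E _ _ `&` _]setIC grid0 -/f in h.
    by have := ler_wpM2r p0 hB; lra.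
  rewrite -mulr_sumr.
  have := pr_partition P (Su u) (fun i => mS u i u0) measurableT.
  rewrite prT; under eq_bigr do rewrite setIT; move=> <-.
  by rewrite mulr1.
(* [G u] is the event that no dip follows site [u] when the passage from [u]
   starts after the rounded passage time to [u] and a wait. *)
pose bad w u := `[< G u w >].
pose D := delta + unit_cost + (unit_cost - th) * B%:R + `|th|.
(* The constant [D] collects the first site, the last overshoot, the rounding
   of the passage to [N], and the term of slope [th] of the first site. *)
have cover w N : tame w -> (0 < N)%N ->
    delta * (S N w)%:R <= D + th * N%:R
      + (unit_cost - th) * \sum_(u < N) \1_(G u.+1) w.
  move=> sw N0.
  pose x u := X 0 0%N u w.
  have x0 u : (0 < u)%N -> 0 <= x u by move=> u0; exact: X_ge0.
  have SE u : (0 < u)%N -> S u w = grid_count delta (x u).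
    move=> u0; have := tame_steps 0 0 sw u0.
    by rewrite /grid !mulr0 addr0.
  have Sle u : (0 < u)%N -> delta * (S u w)%:R <= x u + delta.
    by move=> u0; rewrite SE// grid_count_leD// x0.
  have cat u n j : (0 < u)%N -> (u < n)%N ->
      x n <= grid (S u w) j.+1 + X (grid (S u w) j.+1) u n w.
    move=> u0 un; have := @concat_grid 0 0 j 0 u n w (S u w) u0 un.
    rewrite !add0n {1 2}/grid !mulr0 addr0; apply; exact: SE.
  have xS u : (0 < u)%N -> x u.+1 <= x u + unit_cost.
    move=> u0; apply: le_trans (cat u u.+1 0%N u0 (ltnSn u)) _.
    have := sw (S u w) I 1%N I u I; rewrite /= => h.
    have := Sle u u0; have := unit_cost_ge; move: h.
    by rewrite {2}/grid; set Z := X _ _ _ _; rewrite mulr1; lra.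
  have xK : x 1%N <= unit_cost.
    apply: le_trans (X_first w) _.
    by have := unit_cost_ge; have := C_gt0; have := delta_gt0; lra.
  have good u : (0 < u)%N -> ~~ bad w u ->
      exists n, (0 < n <= B)%N /\ x (u + n)%N <= x u + th * n%:R.
    move=> u0 /asboolPn nG.
    have Ew : E (grid (S u w) g.+1) u w.
      by apply: contrapT => nE; apply: nG; exists (S u w).
    have [n /= nB hn] := Ew.
    exists n.+1; split=> //.
    have un : (u < u + n.+1)%N by rewrite addnS ltnS leq_addr.
    apply: (le_trans (cat u (u + n.+1)%N g u0 un)).
    have := Sle u u0; move: hn; rewrite /profile /grid.
    by set Z := X _ _ _ _; lra.
  have := greedy_covering thK xS good (N := N) (u := 1%N); rewrite N0 => /(_ isT).
  have -> : (\sum_(1 <= v < N) bad w v)%:R = \sum_(1 <= v < N) \1_(G v) w :> R.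
    by rewrite natr_sum; apply: eq_bigr => v _; rewrite indicE.
  have -> : \sum_(1 <= v < N) \1_(G v) w = \sum_(u < N.-1) \1_(G u.+1) w :> R.
    by rewrite big_add1 big_mkord.
  have hle : \sum_(u < N.-1) \1_(G u.+1) w <= \sum_(u < N) \1_(G u.+1) w :> R.
    by case: (N) N0 => [//|k] _; rewrite [leRHS]big_ord_recr/= lerDl.
  have hN : (N - 1)%:R = N%:R - 1 :> R by rewrite natrB.
  have := ler_wpM2l (ltW Kth) hle; have := Sle N N0.
  have : - th <= `|th| by rewrite -normrN ler_norm.
  by rewrite hN /D; lra.
have bG u : bounded_rv (\1_(G u.+1) : Omega -> R).
  by apply: bounded_rv_indic; exact: mG.
have bsum N : bounded_rv (fun w => \sum_(u < N) \1_(G u.+1) w : R).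
  exact: bounded_rv_sum.
have mean_cover N : (0 < N)%N ->
    delta * mean_steps N <= D + th * N%:R + (unit_cost - th) * (N%:R * (eta + f)).
  move=> N0; rewrite /mean_steps -meanZ; last exact: bounded_steps.
  have bR : bounded_rv (fun w => (D + th * N%:R) +
      (unit_cost - th) * \sum_(u < N) \1_(G u.+1) w).
    by apply: bounded_rvD; [exact: bounded_rv_cst|exact: bounded_rvZ].
  have := mean_le_as measurable_tame tame_as (bounded_rvZ delta (bounded_steps N0))
    bR (fun w sw => cover w N sw N0).
  move/le_trans; apply.
  rewrite meanD; [|exact: bounded_rv_cst|exact: bounded_rvZ].
  rewrite mean_cst meanZ// mean_sum// lerD2l ler_wpM2l ?(ltW Kth)//.
  rewrite mulr_natl -[N in leRHS]card_ord -sumr_const.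
  by apply: ler_sum => u _; rewrite mean_indic ?prG//; exact: mG.
have e40 : 0 < e / 4 by rewrite divr_gt0.
have [n0 hn0] := freq _ e40.
pose N := (maxn n0 (Num.truncn (4 * D / e)).+1).
have N0 : (0 < N)%N by rewrite /N leq_max orbT.
have Np : 0 < N%:R :> R by rewrite ltr0n.
have DN : 4 * D < e * N%:R.
  have : 4 * D / e < N%:R.
    by apply: lt_le_trans (truncnS_gt _) _; rewrite ler_nat leq_maxr.
  by rewrite ltr_pdivrMr// [e * _]mulrC.
have := hn0 N (leq_maxl _ _); rewrite ler_pdivlMr// => h1.
have h2 := mean_cover N N0.
have h3 : (unit_cost - th) * (N%:R * (eta + f)) <= e / 4 * N%:R.
  rewrite mulrCA mulrC ler_wpM2r//.
  apply: (@le_trans _ _ ((unit_cost - th) * (2 * eta))).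
    by rewrite ler_wpM2l ?(ltW Kth)//; lra.
  by rewrite le_eqVlt; apply/orP; left; apply/eqP; rewrite /eta; field; rewrite gt_eqF.
have eE : e * N%:R = l * N%:R - th * N%:R by rewrite /e mulrBl.
have eNp : 0 < e * N%:R by rewrite mulr_gt0.
have h4 : (l - e / 4) * N%:R = l * N%:R - e * N%:R / 4 by ring.
have h5 : e / 4 * N%:R = e * N%:R / 4 by ring.
rewrite h4 in h1; rewrite h5 in h3.
move: h1 h2 h3 DN eE eNp.
set a1 := l * _; set a2 := th * _; set a3 := e * N%:R; lra.
Qed.

(** * Almost sure convergence *)

Lemma measurable_passage t m n : 0 <= t -> (m < n)%N -> measurable_fun setT (X t m n).
Proof.
by move=> t0 mn _ B mB; rewrite setTI; apply: (Fp_sub t0); exact: X_plus.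
Qed.

Lemma mean_steps_bounds n : 0 <= delta * mean_steps n / n%:R <= unit_cost.
Proof.
case: n => [|n]; first by rewrite invr0 mulr0 lexx ltW// unit_cost_gt0.
have n0 : 0 < n.+1%:R :> R by rewrite ltr0n.
rewrite ler_pdivlMr// mul0r ler_pdivrMr// mean_stepsE// /unit_cost.
have m u : measurable [set w | (u < steps 0 0%N n.+1 w)%N].
  exact: measurable_steps_gt.
rewrite mulr_ge0 ?(ltW delta_gt0)//=; last by apply: sumr_ge0 => i _; exact: pr_ge0.
rewrite -mulrA ler_pM2l// -natrM mulnC.
rewrite -[X in _ <= X%:R]card_ord -sumr_const.
by apply: ler_sum => u _; exact: pr_le1.
Qed.

Lemma lower_as (l th : R) : th < l -> l <= unit_cost ->
  (forall e, 0 < e -> exists n0, forall n, (n0 <= n)%N ->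
     l - e <= delta * mean_steps n / n%:R) ->
  {ae P, forall w, exists L : nat, forall n, th * n.+1%:R - L%:R < X 0 0%N n.+1 w}.
Proof.
move=> thl lK freq; have V0 := lower_null thl lK freq.
have mV := measurable_profile 0 (lexx 0) (seq_measurable_deep_dips th).
exists (profile 0 0 @^-1` deep_dips th); split=> //; first by rewrite measure_prE// V0.
move=> w /= nw L _; apply: contrapT => nL; apply: nw; exists L => n.
rewrite ltNge; apply/negP => h; apply: nL; exists n => //.
Qed.

(** [l] is the lower limit of the normalized means of [steps]: the upper bound
    uses that they are infinitely often close to [l], the lower bound that they
    are eventually not below [l]. *)
Lemma passage_time_constant : time_constant_limits P (X 0 0%N) phi.
Proof.
have [l [/andP[l0 lK] freq_lo freq_hi]] := liminf_exists mean_steps_bounds.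
have inv0 (k : nat) : 0 < k.+1%:R^-1 :> R by rewrite invr_gt0.
have upper : {ae P, forall w, forall k : nat, exists n0, forall n, (n0 <= n)%N ->
    X 0 0%N n w <= (l + k.+1%:R^-1) * n%:R}.
  by apply: ae_foralln => k; apply: upper_as.
have lower : {ae P, forall w, forall k : nat, exists L : nat, forall n,
    (l - k.+1%:R^-1) * n.+1%:R - L%:R < X 0 0%N n.+1 w}.
  apply: ae_foralln => k; apply: (lower_as _ lK freq_lo).
  by rewrite ltrBlDr ltrDl.
have cvg_as : {ae P, forall w, X 0 0%N n.+1 w / n.+1%:R @[n --> \oo] --> l}.
  apply: filterS2 upper lower => w up lo.
  apply/cvgrPdist_le => e e0.
  have e20 : 0 < e / 2 by rewrite divr_gt0.
  have [k ke] : exists k : nat, k.+1%:R^-1 <= e / 2.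
    exists (Num.truncn (e / 2)^-1).
    by rewrite invf_ple ?posrE//; exact/ltW/truncnS_gt.
  have [n1 h1] := up k; have [L h2] := lo k.
  pose n2 := (Num.truncn (L%:R / (e / 2))).+1.
  exists (maxn n1 n2) => // n /=; rewrite geq_max => /andP[n1n n2n].
  have n0 : 0 < n.+1%:R :> R by rewrite ltr0n.
  have Ln : L%:R <= e / 2 * n.+1%:R.
    rewrite mulrC -ler_pdivrMr//; apply: le_trans (ltW (truncnS_gt _)) _.
    by rewrite ler_nat (leq_trans n2n).
  have := h1 n.+1 (leqW n1n); have := h2 n => h3 h4.
  rewrite ler_norml; apply/andP; split.
    rewrite lerNl opprB lerBlDr ler_pdivrMr//; apply: (le_trans h4).
    by rewrite ler_wpM2r// [e + l]addrC lerD2l (le_trans ke)// ler_pdivrMr// ler_peMr ?ler1n// ltW.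
  rewrite lerBlDr -lerBlDl ler_pdivlMr//; apply: le_trans (ltW h3).
  have := ler_wpM2r (ltW n0) ke.
  rewrite (mulrBl _ l e) (mulrBl _ l k.+1%:R^-1) {2}(splitr e) mulrDl.
  by move: Ln; set a := e / 2 * _; set b := _ * n.+1%:R; set c := _ * n.+1%:R; lra.
have mZ n : measurable_fun setT (fun w => X 0 0%N n.+1 w / n.+1%:R).
  by apply: measurable_funM => //; exact: measurable_passage.
have bZ : {ae P, forall w n, `|X 0 0%N n.+1 w / n.+1%:R| <= unit_cost}.
  apply: filterS tame_ae => w sw n.
  have x0 : 0 <= X 0 0%N n.+1 w by exact: X_ge0.
  rewrite ger0_norm ?divr_ge0// ler_pdivrMr//.
  by have := tame_bound 0 0 0 n sw; rewrite /grid !mulr0 addr0.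
have [hE hP] := ae_cvg_mean_probability mZ bZ cvg_as.
exists l; split.
- rewrite -cvg_shiftS; rewrite (_ : (fun n => 'E_P[_])%E =
      (fun n => 'E_P[X 0 0%N n.+1] * (n.+1%:R^-1)%:E)%E) in hE => //.
  apply/funext => n; rewrite unlock -ge0_integralZr//.
  + exact/measurable_EFinP/measurable_passage.
  + by move=> w _; rewrite lee_fin X_ge0.
- by move=> e e0; rewrite -cvg_shiftS; exact: hP.
- by move=> _; apply: filterS cvg_as => w h; rewrite -cvg_shiftS; exact: h.
Qed.

End passage_times.

(** * Rounding and waiting under the time shift bound *)

Section reductions.
Context (R : realType) (T : Type) (X : R -> nat -> nat -> T -> R) (C : R).

Lemma time_shift_iter c t m n j w : 0 <= C -> 0 <= c -> time_shift_bound X C c ->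
  0 <= t -> (m < n)%N -> X t m n w <= X (t + C * j%:R) m n w + C * j%:R.
Proof.
move=> C0 c0 shift t0 mn; elim: j => [|j IHj]; first by rewrite mulr0 !addr0.
apply: (le_trans IHj).
have tj : 0 <= t + C * j%:R by rewrite addr_ge0// mulr_ge0.
have Cc : C <= C <= C + c by rewrite lexx lerDl.
have := shift _ _ m n w tj mn Cc.
rewrite -natr1 mulrDr mulr1 [t + (_ + C)]addrA.
by set a := X _ _ _ _; set b := X _ _ _ _; lra.
Qed.

Hypothesis X_ge0 : forall t m n w, 0 <= t -> (m < n)%N -> 0 <= X t m n w.
Hypothesis subadd : forall t m k n w, 0 <= t -> (m < k)%N -> (k < n)%N ->
  X t m n w <= X t m k w + X (t + X t m k w) k n w.

(** The passage from [k] is compared with one that starts after rounding up and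
    waiting: the delay is [C] plus a rounding of at most [c], followed by [j] more
    delays of [C]. *)
Lemma concat_after_wait c delta t m k n j w r : 0 <= C -> 0 <= c -> 0 < delta ->
  time_shift_bound X C c ->
  delta * (grid_count delta (X t m k w))%:R <= X t m k w + c ->
  0 <= t -> (m < k)%N -> (k < n)%N ->
  r = delta * (grid_count delta (X t m k w))%:R + C * j.+1%:R ->
  X t m n w <= r + X (t + r) k n w.
Proof.
move=> C0 c0 d0 shift hN t0 mk kn ->.
have x0 := X_ge0 w t0 mk.
have := grid_count_ge d0 x0.
have := subadd w t0 mk kn.
move: (X t m k w) hN x0 => x; set y := delta * _ => hN x0 h1 h2.
have tx : 0 <= t + x by rewrite addr_ge0.
have Cc : C <= y - x + C <= C + c by lra.
have := shift _ _ _ _ w tx kn Cc.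
have -> : t + x + (y - x + C) = t + y + C by ring.
have tyC : 0 <= t + y + C by lra.
have := time_shift_iter j w C0 c0 shift tyC kn.
have -> : t + y + C + C * j%:R = t + (y + C * j.+1%:R).
  by rewrite -natr1; ring.
rewrite -natr1 mulrDr mulr1.
by move: h1; set a := X t m n w; set b := X _ k n w; set b' := X _ k n w;
  set b'' := X _ k n w; lra.
Qed.

End reductions.

Theorem theorem1p2 (R : realType) (d : measure_display) (Omega : measurableType d)
    (P : probability Omega R) (Fm Fp : R -> set (set Omega))
    (X : R -> nat -> nat -> Omega -> R) (C : R)
    (Fm_sigma : forall t, 0 <= t -> sigma_algebra setT (Fm t))
    (Fp_sigma : forall t, 0 <= t -> sigma_algebra setT (Fp t))
    (Fm_mono : forall s t, 0 <= s <= t -> Fm s `<=` Fm t)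
    (Fp_mono : forall s t, 0 <= s <= t -> Fp t `<=` Fp s)
    (Fm_sub : forall t, 0 <= t -> Fm t `<=` @measurable _ Omega)
    (Fp_sub : forall t, 0 <= t -> Fp t `<=` @measurable _ Omega)
    (X_meas : forall t m n, 0 <= t -> (m < n)%N ->
       measurable_fun setT (X t m n))
    (X_ge0 : forall t m n w, 0 <= t -> (m < n)%N -> 0 <= X t m n w)
    (C_ge0 : 0 <= C)
    (H1 : forall t m k n w, 0 <= t -> (m < k)%N -> (k < n)%N ->
       X t m n w <= X t m k w + X (t + X t m k w) k n w)
    (H2 : forall w, X 0 0%N 1%N w <= C)
    (H3 : forall t t' m m', 0 <= t -> 0 <= t' ->
       same_joint_law P (fun i => X t m (m + i.+1)%N)
                        (fun i => X t' m' (m' + i.+1)%N))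
    (H4_plus : forall t m n, 0 <= t -> (m < n)%N ->
       forall B : set R, measurable B -> Fp t (X t m n @^-1` B))
    (H4_minus : forall t s m n, 0 <= t -> 0 <= s -> (m < n)%N ->
       Fm (t + s) [set w | X t m n w <= s])
    (H5 : mixing_coef P Fm Fp s @[s --> +oo] --> 0) :
  ((exists2 c : R, 0 < c & time_shift_bound X C c) ->
     time_constant_limits P (X 0 0%N) (mixing_coef P Fm Fp))
  /\
  (0 < C -> C \is a Num.nat ->
   (forall t m n w, 0 <= t -> (m < n)%N -> X t m n w \is a Num.int) ->
   time_shift_bound X C 0 ->
     time_constant_limits P (X 0 0%N) (mixing_coef P Fm Fp)).

Proof.
split.
- move=> [c c0 shift].
  have c20 : 0 < c / 2 by rewrite divr_gt0.
  have C'0 : 0 < C + c / 2 by rewrite ltr_wpDl.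
  (* Replacing [C] by [C + c / 2] makes the waits positive even if [C = 0]. *)
  have shift' : time_shift_bound X (C + c / 2) (c / 2).
    move=> t s m n w t0 mn /andP[h1 h2]; apply: shift => //.
    by apply/andP; split; lra.
  apply: (@passage_time_constant R d Omega P Fm Fp X (C + c / 2) (c / 2)) => //.
  + by move=> w; apply: le_trans (H2 w) _; rewrite lerDl ltW.
  + move=> t m n j w t0 mn.
    exact: (time_shift_iter j w (ltW C'0) (ltW c20) shift' t0 mn).
  + move=> t m k n j w r t0 mk kn.
    apply: (concat_after_wait X_ge0 H1 (ltW C'0) (ltW c20) c20 shift' _ t0 mk kn).
    exact: (grid_count_leD c20 (X_ge0 _ _ _ w t0 mk)).
- move=> C0 _ Xint shift.
  apply: (@passage_time_constant R d Omega P Fm Fp X C 1) => //.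
  + move=> t m n j w t0 mn.
    exact: (time_shift_iter j w C_ge0 (lexx 0) shift t0 mn).
  + move=> t m k n j w r t0 mk kn.
    apply: (concat_after_wait X_ge0 H1 C_ge0 (lexx 0) ltr01 shift _ t0 mk kn).
    have x0 := X_ge0 _ _ _ w t0 mk.
    have /natrP[x xE] : X t m k w \is a Num.nat.
      by rewrite natrEint Xint// x0.
    by rewrite addr0 mul1r {2}xE ler_nat grid_count_le// mul1r xE.
Qed.
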